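(* Let $X$ be a smooth $k$-curve, let $\mathcal{M}$ be a locally finitely generated unit $\mathcal{O}_{F^r,X}$-module, and let $x$ be a closed point of $X$. Then the natural homomorphism $$\mathcal{H}om_{\mathcal{O}_{F^r,X}}(\mathcal{M}, \mathcal{O}_X)_x \to \operatorname{Hom}_{\mathcal{O}_{X,x}[F^r]}(\mathcal{M}_x, \mathcal{O}_{X,x})$$ is an isomorphism.
   Context: $p$ is a prime, $r$ is a positive integer, and $k$ is an algebraically closed field of characteristic $p$. All schemes are noetherian and separated and all sheaves are sheaves on étale sites; $\mathcal{O}_X$ is the étale structure sheaf, quasi-coherent modules are viewed as étale sheaves, stalks are étale stalks, and $\mathcal{H}om$ is the sheaf Hom. For a $k$-algebra $S$, $S[F^r]$ is the twisted polynomial ring of finite sums $\sum_i s_iF^{ri}$ with $F^rs = s^{p^r}F^r$. For a $k$-scheme $X$ with absolute Frobenius $F_X$, $\mathcal{O}_{F^r,X}$ is the sheaf of rings whose sections over an affine $\operatorname{Spec} T$ are $T[F^r]$. A left $\mathcal{O}_{F^r,X}$-module is an $\mathcal{O}_X$-module with an additive endomorphism $F^r$ satisfying $F^r(sm) = s^{p^r}F^r(m)$; its structural morphism is the $\mathcal{O}_X$-linear map $F_X^{r*}\mathcal{M}\to\mathcal{M}$, $a \otimes m \mapsto aF^r(m)$. It is unit if it is quasi-coherent over $\mathcal{O}_X$ and the structural morphism is an isomorphism; a unit module is locally finitely generated if its restriction to any affine open subset is finitely generated as a left $\mathcal{O}_{F^r,X}$-module. $\mathcal{O}_X$ is a left $\mathcal{O}_{F^r,X}$-module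 via the $p^r$th power map. *)

(* Defs.v *)
From HB Require Import structures.
From mathcomp Require Import all_boot all_algebra all_classical topology.

Set Implicit Arguments.
Unset Strict Implicit.
Unset Printing Implicit Defensive.

Import GRing.Theory.
Local Open Scope classical_set_scope.
Local Open Scope ring_scope.

(* Rings are [comPzRingType]s: the zero ring is the ring of sections over the
   empty set. *)

Definition prime_ideal (A : comPzRingType) (P : set A) : Prop :=
  [/\ P 0, forall a b, P a -> P b -> P (a + b), forall a b, P b -> P (a * b),
      ~ P 1 & forall a b, P (a * b) -> P a \/ P b].

(* [phi] is a localization of [A] at the powers of [s]. *)
Definition is_localization (A B : comPzRingType) (s : A)
    (phi : {rmorphism A -> B}) : Prop :=
  [/\ exists b, phi s * b = 1,
      forall b, exists n a, phi s ^+ n * b = phi a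
    & forall a, phi a = 0 -> exists n, s ^+ n * a = 0].

Definition finite_type (A B : comPzRingType) (phi : {rmorphism A -> B}) : Prop :=
  exists (n : nat) (b : 'I_n -> B), forall S : set B,
    (forall a, S (phi a)) -> (forall i, S (b i)) ->
    (forall x y, S x -> S y -> S (x + y)) ->
    (forall x y, S x -> S y -> S (x * y)) -> forall x, S x.

(* Unique infinitesimal lifting; a square-zero ideal is presented as the kernel
   of a surjection [pi : C -> D]. *)
Definition formally_etale (A B : comPzRingType) (phi : {rmorphism A -> B}) : Prop :=
  forall (C D : comPzRingType) (pi : {rmorphism C -> D}),
    (forall d, exists c, pi c = d) ->
    (forall c c', pi c = 0 -> pi c' = 0 -> c * c' = 0) ->
  forall (f : {rmorphism A -> C}) (g : {rmorphism B -> D}),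
    (forall a, pi (f a) = g (phi a)) ->
  exists h : {rmorphism B -> C},
    [/\ forall a, h (phi a) = f a, forall b, pi (h b) = g b
      & forall h' : {rmorphism B -> C}, (forall a, h' (phi a) = f a) ->
          (forall b, pi (h' b) = g b) -> h' =1 h].

(* Only used over noetherian rings, where finite type and finite presentation
   agree. *)
Definition etale_ring (A B : comPzRingType) (phi : {rmorphism A -> B}) : Prop :=
  finite_type phi /\ formally_etale phi.

Definition semilinear_map (A B : comPzRingType) (phi : A -> B)
    (M : lmodType A) (N : lmodType B) (f : M -> N) : Prop :=
  (forall x y, f (x + y) = f x + f y) /\ (forall a x, f (a *: x) = phi a *: f x).

(* [i] exhibits [N] as [B (x)_A M], i.e. [b (x) m |-> b *: i m] is an
   isomorphism, [B] being an [A]-algebra through [phi]. *)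
Definition is_base_change (A B : comPzRingType) (phi : A -> B)
    (M : lmodType A) (N : lmodType B) (i : M -> N) : Prop :=
  semilinear_map phi i /\
  forall (P : lmodType B) (f : M -> P), semilinear_map phi f ->
  exists g : {linear N -> P}, (forall m, g (i m) = f m) /\
    forall g' : {linear N -> P}, (forall m, g' (i m) = f m) -> g' =1 g.

Record opens (T : topologicalType) := Opens {
  oset :> set T;
  oset_open : open oset }.

Definition openW (T : topologicalType) : opens T := Opens openT.

Record ringedSpace := RingedSpace {
  carrier :> topologicalType;
  sec : opens carrier -> comPzRingType;
  res : forall U V : opens carrier, V `<=` U -> {rmorphism sec U -> sec V};
  res_id : forall (U : opens carrier) (h : U `<=` U) s, res h s = s;
  res_comp : forall (U V W : opens carrier) (hVU : V `<=` U) (hWV : W `<=` V)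
    (hWU : W `<=` U) s, res hWV (res hVU s) = res hWU s;
  sec_separated : forall (I : Type) (U : opens carrier) (V : I -> opens carrier)
    (h : forall i, V i `<=` U), U `<=` \bigcup_i V i ->
    forall s t : sec U, (forall i, res (h i) s = res (h i) t) -> s = t;
  sec_glue : forall (I : Type) (U : opens carrier) (V : I -> opens carrier)
    (h : forall i, V i `<=` U), U `<=` \bigcup_i V i ->
    forall s : forall i, sec (V i),
    (forall i j (W : opens carrier) (hi : W `<=` V i) (hj : W `<=` V j),
       res hi (s i) = res hj (s j)) ->
    exists t : sec U, forall i, res (h i) t = s i }.

Definition gsec (X : ringedSpace) : comPzRingType := sec (openW X).

(* The germ of [s] at [x] is a unit of the (Zariski) local ring at [x]. *)
Definition unit_at (X : ringedSpace) (U : opens X) (s : sec U) (x : X) : Prop :=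
  exists (V : opens X) (h : V `<=` U), oset V x /\
    exists t : sec V, res h s * t = 1.

(* The ring of germs at [x] is local: it is nonzero, and [s] or [1 - s] is a
   unit for each germ [s]. *)
Definition locally_ringed (X : ringedSpace) : Prop :=
  forall x : X,
    ~ unit_at (0 : gsec X) x /\
    forall (U : opens X) (s : sec U), oset U x -> unit_at s x \/ unit_at (1 - s) x.

(* The open subspace [U] is isomorphic to Spec of [A := sec U]: the map sending
   [y] in [U] to the prime of the sections not invertible at [y] is a
   homeomorphism onto the set of primes of [A], with the topology generated by
   the sets [D(s)] of primes not containing [s], and the sections over [D(s)]
   are the localization of [A] at [s]. *)
Definition affine_open (X : ringedSpace) (U : opens X) : Prop :=
  [/\ forall y, oset U y -> prime_ideal [set s : sec U | ~ unit_at s y],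
      forall P : set (sec U), prime_ideal P ->
        exists! y, oset U y /\ P = [set s : sec U | ~ unit_at s y],
      forall (V : opens X) y, oset U y -> oset V y ->
        exists s : sec U, unit_at s y /\
          forall z, oset U z -> unit_at s z -> oset V z
    & forall (s : sec U) (V : opens X) (h : V `<=` U),
        (forall y, oset V y <-> oset U y /\ unit_at s y) ->
        is_localization s (res h)].

Record scheme := Scheme {
  sspace :> ringedSpace;
  scheme_local : locally_ringed sspace;
  scheme_affine : forall x : sspace,
    exists U : opens sspace, oset U x /\ affine_open U }.

Definition affine_scheme (X : scheme) : Prop := affine_open (openW X).

(* The comorphism is given as ring maps [O_Y(V) -> O_X(U)] for all [U] contained
   in the preimage of [V]; these are the compositions of [O_Y(V) -> O_X(f^-1 V)]
   with restriction. *)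
Record mor (X Y : ringedSpace) := Mor {
  mfun :> X -> Y;
  mor_cont : continuous mfun;
  pull : forall (V : opens Y) (U : opens X), U `<=` mfun @^-1` V ->
    {rmorphism sec V -> sec U};
  pull_res : forall (V V' : opens Y) (U U' : opens X)
    (h : U `<=` mfun @^-1` V) (h' : U' `<=` mfun @^-1` V')
    (hV : V' `<=` V) (hU : U' `<=` U) s,
    res hU (pull h s) = pull h' (res hV s);
  pull_local : forall (V : opens Y) (U : opens X) (h : U `<=` mfun @^-1` V)
    (s : sec V) x, oset U x -> unit_at (pull h s) x -> unit_at s (mfun x) }.
Arguments pull {X Y} m {V U}.

Lemma rmorphism_ext (A B : comPzRingType) (f g : {rmorphism A -> B}) :
  f =1 g -> f = g.
Proof.
case: f g => [f cf] [g cg] /= /funext e; subst g; congr GRing.RMorphism.Pack.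
case: cf cg => [[a] [b]] [[a'] [b']].
by rewrite (Prop_irrelevance a a') (Prop_irrelevance b b').
Qed.

Lemma mor_ext (X Y : ringedSpace) (f g : mor X Y) : f =1 g ->
  (forall (V : opens Y) (U : opens X) (h : U `<=` f @^-1` V)
     (h' : U `<=` g @^-1` V) s, pull f h s = pull g h' s) -> f = g.
Proof.
case: f g => [f c p r l] [g c' p' r' l'] /= /funext e; subst g => e.
have {}e : p = p'.
  apply: functional_extensionality_dep => V.
  apply: functional_extensionality_dep => U.
  by apply: functional_extensionality_dep => h; apply: rmorphism_ext => s; exact: e.
subst p'.
by rewrite (Prop_irrelevance c c') (Prop_irrelevance r r') (Prop_irrelevance l l').
Qed.

Section Category.
Variables X Y : ringedSpace.

Lemma open_preimage (f : mor X Y) (V : opens Y) : open (f @^-1` V).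
Proof. by apply: (continuousP _).1; [exact: mor_cont | exact: oset_open]. Qed.

Definition opre (f : mor X Y) (V : opens Y) : opens X :=
  Opens (open_preimage f V).

Definition mor_id : mor X X.
Proof.
refine (@Mor X X id _ (fun V U h => @res X V U h) _ _).
- by move=> x; exact: cvg_id.
- by move=> V V' U U' h h' hV hU s; rewrite !(res_comp _ _ (subset_trans hU h)).
- move=> V U h s x _ [W [hW [Wx [t ht]]]].
  exists W, (subset_trans hW h); split=> //.
  by exists t; rewrite -(res_comp h hW).
Defined.

Lemma sub_opre (f : mor X Y) (V : opens Y) : opre f V `<=` f @^-1` V.
Proof. by []. Qed.

End Category.

Definition mor_comp (X Y Z : ringedSpace) (f : mor Y Z) (g : mor X Y) : mor X Z.
Proof.
refine (@Mor X Z (f \o g) _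
  (fun V U h => (pull g (V := opre f V) (U := U) h \o
                 pull f (@sub_opre _ _ f V))
                : {rmorphism sec V -> sec U}) _ _).
- by move=> x; apply: continuous_comp; exact: mor_cont.
- move=> V V' U U' h h' hV hU s /=.
  have hp : opre f V' `<=` opre f V by move=> y /=; exact: hV.
  by rewrite -(pull_res (@sub_opre _ _ f V) (@sub_opre _ _ f V') hV hp)
             (pull_res _ (h' : oset U' `<=` g @^-1` opre f V') hp).
- move=> V U h s x Ux /(pull_local Ux) ug.
  exact: pull_local (h x Ux : oset (opre f V) (g x)) ug.
Defined.

Lemma mor_compA (X Y Z T : ringedSpace) (f : mor Z T) (g : mor Y Z) (h : mor X Y) :
  mor_comp f (mor_comp g h) = mor_comp (mor_comp f g) h.
Proof.
apply: mor_ext => [//|V U k k' s] /=.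
set W := opre g (opre f V); set W' := opre (mor_comp f g) V.
have hW : W `<=` W' by [].
have hU : U `<=` U by [].
have kW : U `<=` h @^-1` W by exact: k.
have kW' : U `<=` h @^-1` W' by exact: k'.
have gW : W' `<=` g @^-1` opre f V by [].
have hV : opre f V `<=` opre f V by [].
transitivity (pull h kW (res hW (pull g gW (pull f (@sub_opre _ _ f V) s)))).
  by rewrite (pull_res gW (@sub_opre _ _ g (opre f V)) hV hW) res_id
             (Prop_irrelevance kW k).
rewrite -(pull_res kW' kW hW hU) res_id.
rewrite (Prop_irrelevance kW' k').
by rewrite (Prop_irrelevance gW (@sub_opre _ _ (mor_comp f g) V)).
Qed.

Lemma mor_compf1 (X Y : ringedSpace) (f : mor X Y) : mor_comp f (mor_id X) = f.
Proof.
apply: mor_ext => [//|V U h h' s] /=.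
have hV : V `<=` V by [].
by rewrite (pull_res (@sub_opre _ _ f V) h' hV h) res_id.
Qed.

Definition gpull (X Y : ringedSpace) (f : mor X Y) :
    {rmorphism gsec Y -> gsec X} :=
  pull f (fun _ _ => I : oset (openW Y) _).

Definition is_product (X Y P : scheme) (p : mor P X) (q : mor P Y) : Prop :=
  forall (T : scheme) (a : mor T X) (b : mor T Y),
    exists! c : mor T P, mor_comp p c = a /\ mor_comp q c = b.

(* A homeomorphism onto a closed subset which is surjective on local rings. *)
Definition closed_immersion (X Y : scheme) (i : mor X Y) : Prop :=
  [/\ injective i, closed (range i),
      forall U : opens X, exists V : opens Y, oset U = i @^-1` V
    & forall (x : X) (U : opens X) (s : sec U), oset U x ->
        exists (V : opens Y) (W : opens X) (hU : W `<=` U)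
          (hV : W `<=` i @^-1` V), oset W x /\
          exists t : sec V, pull i hV t = res hU s].

Definition open_immersion (X Y : scheme) (j : mor X Y) : Prop :=
  [/\ injective j, forall U : opens X, open (j @` U)
    & forall (U : opens X) (V : opens Y) (h : U `<=` j @^-1` V),
        oset V = j @` U -> bijective (pull j h)].

(* The diagonal is a closed immersion; separatedness over Spec Z and over a base
   field are the same. *)
Definition separated (X : scheme) : Prop :=
  exists (P : scheme) (p q : mor P X) (d : mor X P),
    [/\ is_product p q, mor_comp p d = mor_id X, mor_comp q d = mor_id X
      & closed_immersion d].

Definition etale (X Y : scheme) (f : mor X Y) : Prop :=
  forall x : X, exists (U : opens X) (V : opens Y) (h : U `<=` f @^-1` V),
    [/\ oset U x, affine_open U, affine_open V & etale_ring (pull f h)].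

(* A morphism from [X] to Spec k is a ring map from [k] to the global sections.
   Smoothness of relative dimension 1 is local factorization through an etale
   morphism to the affine line Spec k[t]. *)
Definition smooth_curve (k : fieldType) (X : scheme)
    (s : {rmorphism k -> gsec X}) : Prop :=
  [/\ compact [set: X], separated X
    & forall x : X, exists (U : opens X) (phi : {rmorphism {poly k} -> sec U}),
        [/\ oset U x, affine_open U,
            forall c, phi c%:P = res (@subsetT _ U : oset U `<=` openW X) (s c)
          & etale_ring phi]].

Record etaleOver (X : scheme) := EtaleOver {
  etot :> scheme;
  estr : mor etot X;
  estr_etale : etale estr }.

Record etmor (X : scheme) (V U : etaleOver X) := EtMor {
  emor :> mor V U;
  emor_over : mor_comp (estr U) emor = estr V }.

Definition et_id (X : scheme) (U : etaleOver X) : etmor U U :=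
  EtMor (mor_compf1 (estr U)).

Lemma et_comp_over (X : scheme) (W V U : etaleOver X) (f : etmor V U)
  (g : etmor W V) : mor_comp (estr U) (mor_comp f g) = estr W.
Proof. by rewrite mor_compA !emor_over. Qed.

Definition et_comp (X : scheme) (W V U : etaleOver X) (f : etmor V U)
    (g : etmor W V) : etmor W U := EtMor (et_comp_over f g).

Lemma et_ext (X : scheme) (V U : etaleOver X) (f g : etmor V U) :
  emor f = emor g -> f = g.
Proof.
case: f g => [f a] [g b] /= e; subst g.
by rewrite (Prop_irrelevance a b).
Qed.

Lemma et_compA (X : scheme) (T W V U : etaleOver X) (f : etmor V U)
    (g : etmor W V) (h : etmor T W) :
  et_comp f (et_comp g h) = et_comp (et_comp f g) h.
Proof. by apply: et_ext => /=; rewrite mor_compA. Qed.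

Section SetPresheaf.
Variables (X : scheme) (S : etaleOver X -> Type)
  (rS : forall U V : etaleOver X, etmor V U -> S U -> S V).

Definition etale_sheaf : Prop :=
  forall (U : etaleOver X) (I : Type) (V : I -> etaleOver X)
    (g : forall i, etmor (V i) U),
    (forall u : U, exists i v, g i v = u) ->
    forall s : forall i, S (V i),
    (forall i j (W : etaleOver X) (a : etmor W (V i)) (b : etmor W (V j)),
       et_comp (g i) a = et_comp (g j) b -> rS a (s i) = rS b (s j)) ->
    exists! t : S U, forall i, rS (g i) t = s i.

End SetPresheaf.

(* The sheaf of [O_X]-modules [M] on the etale site of [X], with the
   [q]-Frobenius-semilinear endomorphism [mF]; with [q := p ^ r] this is a left
   module over the sheaf of twisted polynomial rings. *)
Record frobModule (X : scheme) (q : nat) := FrobModule {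
  msec :> forall U : etaleOver X, lmodType (gsec U);
  mres : forall U V : etaleOver X, etmor V U -> msec U -> msec V;
  mF : forall U : etaleOver X, msec U -> msec U;
  mres_semilinear : forall (U V : etaleOver X) (g : etmor V U),
    semilinear_map (gpull g) (mres g);
  mres_id : forall (U : etaleOver X) m, mres (et_id U) m = m;
  mres_comp : forall (U V W : etaleOver X) (f : etmor V U) (g : etmor W V) m,
    mres (et_comp f g) m = mres g (mres f m);
  msec_sheaf : etale_sheaf mres;
  mF_semilinear : forall U : etaleOver X,
    semilinear_map (fun a : gsec U => a ^+ q) (@mF U);
  mF_res : forall (U V : etaleOver X) (g : etmor V U) m,
    mres g (mF m) = mF (mres g m) }.
Arguments mres {X q} f {U V} : rename.
Arguments mF {X q} f {U} : rename.

Section FrobeniusModules.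
Variables (X : scheme) (q : nat) (M : frobModule X q).

(* On the affine objects, [M] is the module associated with its sections. *)
Definition quasi_coherent : Prop :=
  forall (U V : etaleOver X) (g : etmor V U),
    affine_scheme U -> affine_scheme V -> is_base_change (gpull g) (mres M g).

(* Over an affine [U] the structural morphism is
   [gsec U (x)_F M U -> M U, a (x) m |-> a *: mF m], the tensor product being
   taken along the [q]-th power map. *)
Definition unit_module : Prop :=
  quasi_coherent /\
  forall U : etaleOver X, affine_scheme U ->
    is_base_change (fun a : gsec U => a ^+ q) (@mF X q M U).

(* Every section over an affine open subset is a combination
   [sum_j (sum_i a_ij F^i) m_j] of finitely many fixed sections [m_j]. *)
Definition locally_fg : Prop :=
  forall U : etaleOver X, affine_scheme U -> open_immersion (estr U) ->
  exists (n : nat) (m : 'I_n -> M U), forall x : M U,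
  exists (d : nat) (a : 'I_d -> 'I_n -> gsec U),
    x = \sum_(j < n) \sum_(i < d) a i j *: iter i (mF M) (m j).

(* Sections over [U] of the sheaf of homomorphisms from [M] to the structure
   sheaf: homomorphisms between the restrictions of these sheaves to [U]. *)
Record homSec (U : etaleOver X) := HomSec {
  happ : forall (V : etaleOver X) (g : etmor V U), {linear M V -> (gsec V)^o};
  happ_F : forall (V : etaleOver X) (g : etmor V U) (m : M V),
    happ g (mF M m) = (happ g m : gsec V) ^+ q;
  happ_res : forall (V W : etaleOver X) (g : etmor V U) (h : etmor W V) (m : M V),
    happ (et_comp g h) (mres M h m) = gpull h (happ g m) }.

Definition hom_res (U U' : etaleOver X) (e : etmor U' U) (f : homSec U) :
  homSec U'.
Proof.
refine (@HomSec U' (fun V g => happ f (et_comp e g)) _ _).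
- by move=> V g m; exact: happ_F.
- by move=> V W g h m; rewrite et_compA happ_res.
Defined.

End FrobeniusModules.

(* Etale neighbourhoods of the geometric point given by a closed point [x]; the
   residue field of [x] is the algebraically closed base field, so that a lift
   of this geometric point to [U] is a point of [U] above [x]. *)
Record etNbhd (X : scheme) (x : X) := EtNbhd {
  nobj :> etaleOver X;
  npt : nobj;
  npt_over : estr nobj npt = x }.

Record nbmor (X : scheme) (x : X) (W N : etNbhd x) := NbMor {
  nmor :> etmor W N;
  nmor_pt : nmor (npt W) = npt N }.

(* [L] is the colimit of [S] over the (cofiltered) category of etale
   neighbourhoods of [x], with canonical maps [germ]. *)
Definition is_stalk (X : scheme) (x : X) (S : etaleOver X -> Type)
    (rS : forall U V : etaleOver X, etmor V U -> S U -> S V)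
    (L : Type) (germ : forall N : etNbhd x, S N -> L) : Prop :=
  (forall l, exists (N : etNbhd x) (s : S N), germ N s = l) /\
  (forall (N N' : etNbhd x) (s : S N) (s' : S N'),
     germ N s = germ N' s' <->
     exists (W : etNbhd x) (a : nbmor W N) (b : nbmor W N'), rS _ _ a s = rS _ _ b s').

Record ringStalk (X : scheme) (x : X) := RingStalk {
  rsT :> comPzRingType;
  rgerm : forall N : etNbhd x, {rmorphism gsec N -> rsT};
  rstalkP : @is_stalk X x (fun U => gsec U) (fun U V g => gpull g) rsT rgerm }.
Arguments rgerm {X x} r N.

Record modStalk (X : scheme) (q : nat) (M : frobModule X q) (x : X)
    (Ox : ringStalk x) := ModStalk {
  msT :> lmodType Ox;
  msF : msT -> msT;
  mgerm : forall N : etNbhd x, M N -> msT;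
  mgerm_semilinear : forall N : etNbhd x, semilinear_map (rgerm Ox N) (@mgerm N);
  mgerm_F : forall (N : etNbhd x) (m : M N), mgerm (mF M m) = msF (mgerm m);
  mstalkP : @is_stalk X x (fun U => M U) (@mres X q M) msT mgerm }.
Arguments mgerm {X q M x Ox} m {N} : rename.

Record homStalk (X : scheme) (q : nat) (M : frobModule X q) (x : X) := HomStalk {
  hsT :> zmodType;
  hgerm : forall N : etNbhd x, homSec M N -> hsT;
  hgerm_add : forall (N : etNbhd x) (f g h : homSec M N),
    (forall (V : etaleOver X) (e : etmor V N) (m : M V),
       happ h e m = happ f e m + happ g e m) ->
    hgerm h = hgerm f + hgerm g;
  hstalkP : @is_stalk X x (homSec M) (@hom_res X q M) hsT hgerm }.
Arguments hgerm {X q M x} h {N} : rename.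

(* Homomorphisms of modules over the twisted polynomial ring from the stalk of
   [M] to the stalk of the structure sheaf. *)
Record stalkHom (X : scheme) (q : nat) (M : frobModule X q) (x : X)
    (Ox : ringStalk x) (Mx : modStalk M Ox) := StalkHom {
  shom :> {linear Mx -> Ox^o};
  shom_F : forall m : Mx, shom (msF m) = (shom m : Ox) ^+ q }.

(* The germ of [f] is sent to the map induced by [f] on germs. As any two germs
   are defined on a common neighbourhood, this determines [Phi]. *)
Definition is_natural_map (X : scheme) (q : nat) (M : frobModule X q) (x : X)
    (Ox : ringStalk x) (Mx : modStalk M Ox) (Hx : homStalk M x)
    (Phi : Hx -> stalkHom Mx) : Prop :=
  forall (N : etNbhd x) (f : homSec M N) (m : M N),
    Phi (hgerm Hx f) (mgerm Mx m) = rgerm Ox N (happ f (et_id N) m).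

(* Main.v *)
Require Import Defs.
From HB Require Import structures.
From mathcomp Require Import all_boot all_algebra all_classical topology.
Import GRing.Theory Pdiv.CommonRing Pdiv.RingMonic.
Local Open Scope classical_set_scope.
Local Open Scope ring_scope.

(** The idea is that the module is finitely presented over the twisted
    polynomial ring, so that a homomorphism out of it is a finite list of
    sections satisfying finitely many equations, and such data spread out from
    the stalk to a neighbourhood.

    Write [q = p ^ r], let [W] be an affine open neighbourhood of [x] that is
    étale over the affine line, [A] its ring of sections and [M] the module of
    sections over [W], with generators [m_j] over [A[F]].  Two properties of [A]
    matter.  It is noetherian ([noetherian_finite_type]).  And Frobenius makes
    it a finite projective module over itself ([etale_frobenius_basis]): there
    are finitely many [t_s] and additive [kappa_s] such that
    [kappa_s (c^q a) = c kappa_s a] and [a = sum_s (kappa_s a)^q t_s].  To find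
    them, adjoin to [A] formal [q]-th roots of its finitely many generators.
    The resulting ring [C] is free over [A], and it maps onto [A] by taking
    [q]-th powers on [A] and each formal root to its generator.  The kernel is
    finitely generated and consists of nilpotent elements, so étaleness lifts
    the identity of [A] to a ring map from [A] to [C]; the [kappa_s] are its
    coordinates.

    The unit condition says that [M] is its own Frobenius pullback.  Hence a
    relation [sum_j a_j F(y_j) = 0] forces [sum_j (kappa_s a_j) y_j = 0] for all
    [s] ([unit_relation]), and conversely these imply it.  The unit condition also
    expresses each [m_j] through the [F^i m_l] with [i > 0].  Together these
    reduce a relation of high degree between the [m_j] to relations of smaller
    degree ([relation_descent]); those of bounded degree form a finitely
    generated [A]-module.  So [M] is finitely presented ([unit_hom_exists]).

    Consequently a homomorphism from [M] to the sections over an étale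
    neighbourhood [N] is given by sections [b_j] satisfying finitely many
    equations.  By quasi-coherence and gluing it then extends to a homomorphism
    of sheaves over [N] ([hom_extension]), and it is determined by the [b_j]
    ([homSec_eq_generators]).  Injectivity and surjectivity follow since
    finitely many equations that hold between germs hold on a neighbourhood.

    That the comparison map is well defined involves two maps from a
    neighbourhood [K] to a neighbourhood [N].  It suffices that, after shrinking
    [K], they pull a given homomorphism back to the same one, and this can be
    read off from the germ of the difference of the two pullbacks
    ([hom_res_equalize]). *)

Set Implicit Arguments.
Unset Strict Implicit.
Unset Printing Implicit Defensive.

(** * Noetherian rings *)

Definition submodule (A : pzRingType) (V : lmodType A) (S : set V) : Prop :=
  [/\ S 0, forall x y, S x -> S y -> S (x + y) & forall a x, S x -> S (a *: x)].

(** The span is defined by its universal property: no coefficients have to be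
    carried along, and lists of generators can be concatenated freely. *)
Definition mspan (A : pzRingType) (V : lmodType A) (l : seq V) : set V :=
  [set x | forall T, submodule T -> (forall v, v \in l -> T v) -> T x].

Definition fin_gen (A : pzRingType) (V : lmodType A) (S : set V) : Prop :=
  exists l : seq V, (forall v, v \in l -> S v) /\ S `<=` mspan l.

Definition ideal (A : pzRingType) (I : set A) : Prop :=
  [/\ I 0, forall x y, I x -> I y -> I (x + y) & forall a x, I x -> I (a * x)].

Definition noetherian (A : pzRingType) : Prop :=
  forall I : set A, ideal I -> exists l : seq A, (forall a, a \in l -> I a) /\
    forall J, ideal J -> (forall a, a \in l -> J a) -> I `<=` J.

Section Span.
Variables (A : pzRingType) (V : lmodType A).
Implicit Types (S : set V) (l : seq V).

Lemma submodule_mspan l : submodule (mspan l).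
Proof.
split=> [T [] //|x y hx hy T hT hl|a x hx T hT hl].
  by case: (hT) => _ hD _; apply: hD; [apply: hx|apply: hy].
by case: (hT) => _ _ hZ; apply: hZ; apply: hx.
Qed.

Lemma submoduleN S x : submodule S -> S x -> S (- x).
Proof. by case=> _ _ hZ hx; rewrite -scaleN1r; exact: hZ. Qed.

Lemma submoduleB S x y : submodule S -> S x -> S y -> S (x - y).
Proof. by move=> hS hx hy; case: (hS) => _ hD _; apply: hD => //; exact: submoduleN. Qed.

Lemma submodule_sum S (I : Type) (r : seq I) (P : pred I) (F : I -> V) :
  submodule S -> (forall i, P i -> S (F i)) -> S (\sum_(i <- r | P i) F i).
Proof. by case=> h0 hD _ hF; elim/big_ind: _. Qed.

Lemma submoduleI S T : submodule S -> submodule T -> submodule (S `&` T).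
Proof.
move=> [? hD hZ] [? hD' hZ']; split=> [|x y [? ?] [? ?]|a x [? ?]]; first by split.
  by split; [apply: hD|apply: hD'].
by split; [apply: hZ|apply: hZ'].
Qed.

Lemma mspan_mem l v : v \in l -> mspan l v.
Proof. by move=> hv T _; apply. Qed.

Lemma mspan_cons g l x : mspan (g :: l) x ->
  exists a y, mspan l y /\ x = a *: g + y.
Proof.
move=> hx; apply: (hx [set x | exists a y, mspan l y /\ x = a *: g + y]) => [|v].
  split.
  - exists 0, 0; rewrite scale0r addr0; split=> //.
    by case: (submodule_mspan l).
  - move=> _ _ [a [y [hy ->]]] [b [z [hz ->]]]; exists (a + b), (y + z).
    rewrite scalerDl addrACA; split=> //.
    by case: (submodule_mspan l) => _ hD _; apply: hD.
  - move=> c _ [a [y [hy ->]]]; exists (c * a), (c *: y).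
    rewrite scalerDr scalerA; split=> //.
    by case: (submodule_mspan l) => _ _; apply.
rewrite inE => /orP[/eqP->|hv].
  exists 1, 0; rewrite scale1r addr0; split=> //.
  by case: (submodule_mspan l).
by exists 0, v; rewrite scale0r add0r; split=> //; exact: mspan_mem.
Qed.

(** Induction on the number of generators: the coefficients of the first
    generator in the elements of [S] form an ideal, and what remains of [S] lies
    in the span of the other generators. *)
Lemma noetherian_fin_gen l S :
  noetherian A -> submodule S -> S `<=` mspan l -> fin_gen S.
Proof.
move=> nA; elim: l S => [|g l IH] S hS Sl.
  exists [::]; split=> // x /Sl hx; exact: hx.
pose I : set A := [set a | exists y, mspan l y /\ S (a *: g + y)].
have [s0 sD sZ] := hS; have [t0 tD tZ] := submodule_mspan l.
have hI : ideal I.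
  split.
  - by exists 0; rewrite scale0r addr0.
  - move=> a b [y [hy Sy]] [z [hz Sz]]; exists (y + z); split; first exact: tD.
    by rewrite scalerDl addrACA; exact: sD.
  - move=> c a [y [hy Sy]]; exists (c *: y); split; first exact: tZ.
    by rewrite -scalerA -scalerDr; exact: sZ.
have [lI [lI1 lI2]] := nA _ hI.
have [l' [l'1 l'2]] : fin_gen (S `&` mspan l).
  apply: IH; first by apply: submoduleI => //; exact: submodule_mspan.
  by move=> x [].
have [f hf] : exists f : A -> V, forall a, a \in lI -> mspan l (f a) /\ S (a *: g + f a).
  have /choice[f hf] : forall a : A, exists y, a \in lI -> mspan l y /\ S (a *: g + y).
    move=> a; case: (boolP (a \in lI)) => [/lI1[y hy]|_]; first by exists y.
    by exists 0.
  by exists f.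
exists ([seq a *: g + f a | a <- lI] ++ l'); split.
  move=> v; rewrite mem_cat => /orP[/mapP[a /hf[_ ?] ->]//|/l'1[]//].
move=> x Sx T hT hl.
have [u0 uD uZ] := hT.
have [a [y [hy xE]]] := mspan_cons (Sl _ Sx).
have Ia : I a by exists y; rewrite -xE.
case: (lI2 [set a | exists y, [/\ mspan l y, S (a *: g + y) & T (a *: g + y)]]
  _ _ a Ia).
- split.
  + by exists 0; rewrite scale0r addr0.
  + move=> c d [z [hz Sz Tz]] [w [hw Sw Tw]]; exists (z + w).
    by rewrite scalerDl addrACA; split; [exact: tD|exact: sD|exact: uD].
  + move=> c d [z [hz Sz Tz]]; exists (c *: z).
    by rewrite -scalerA -scalerDr; split; [exact: tZ|exact: sZ|exact: uZ].
- move=> b hb; have [h1 h2] := hf b hb; exists (f b); split=> //.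
  by apply: hl; rewrite mem_cat; apply/orP; left; exact: map_f.
move=> z [hz Sz Tz].
have -> : x = (a *: g + z) + (x - (a *: g + z)) by rewrite addrC subrK.
apply: uD => //; apply: (l'2 _ _ T hT) => [|v hv]; last first.
  by apply: hl; rewrite mem_cat hv orbT.
split; first exact: submoduleB.
by rewrite xE opprD addrACA subrr add0r; exact: (submoduleB (submodule_mspan l)).
Qed.

End Span.

(** Hilbert's basis theorem.  The leading coefficients of the elements of an
    ideal form a finitely generated ideal of [R], attained in a single degree [d]
    after multiplication by powers of ['X]; the elements of degree less than [d]
    form a submodule of a finitely generated [R]-module. *)
Lemma noetherian_poly (R : comNzRingType) : noetherian R -> noetherian {poly R}.
Proof.
move=> nR I hI; have [i0 iD iZ] := hI.
have iX n (f : {poly R}) : I f -> I ('X^n * f) by exact: iZ.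
pose L (d : nat) : set R :=
  [set a | exists f : {poly R}, [/\ I f, (size f <= d.+1)%N & f`_d = a]].
have LX d e a : (d <= e)%N -> L d a -> L e a.
  move=> le [f [If sf fa]]; exists ('X^(e - d) * f); split; first exact: iX.
    apply: leq_trans (size_polyMleq _ _) _; rewrite size_polyXn addSn /=.
    by rewrite -[X in (_ <= X)%N](subnK (leqW le)) subSn // addSnnS leq_add2l.
  by rewrite coefXnM ltnNge leq_subr /= subKn.
have hL d : ideal (L d).
  split.
  - by exists 0; rewrite size_poly0 coef0; split.
  - move=> _ _ [f [If sf <-]] [g [Ig sg <-]]; exists (f + g).
    rewrite coefD; split=> //; first exact: iD.
    by apply: leq_trans (size_polyD _ _) _; rewrite geq_max sf.
  - move=> c _ [f [If sf <-]]; exists (c%:P * f); split; first exact: iZ.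
      by rewrite mul_polyC; apply: leq_trans (size_scale_leq _ _) _.
    by rewrite coefCM.
have [|lL [lL1 lL2]] := nR (\bigcup_d L d).
  split; first by exists 0%N => //; case: (hL 0%N).
    move=> a b [d _ ha] [e _ hb]; exists (maxn d e) => //.
    by case: (hL (maxn d e)) => _ hD _; apply: hD; [apply: LX ha|apply: LX hb];
      rewrite ?leq_maxl ?leq_maxr.
  by move=> c a [d _ ha]; exists d => //; case: (hL d) => _ _; apply.
have [d hd] : exists d, forall a, a \in lL -> L d a.
  elim: lL lL1 {lL2} => [|a l IH] hl; first by exists 0%N.
  have [|d hd] := IH; first by move=> v hv; apply: hl; rewrite inE hv orbT.
  have [e _ he] := hl a (mem_head _ _); exists (maxn d e) => v.
  rewrite inE => /orP[/eqP->|/hd]; first by apply: LX he; exact: leq_maxr.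
  by apply: LX; exact: leq_maxl.
pose S : set {poly R} := [set f | I f /\ (size f <= d)%N].
have hS : submodule S.
  split; first by split=> //; rewrite size_poly0.
    move=> f g [? sf] [? sg]; split; first exact: iD.
    by apply: leq_trans (size_polyD _ _) _; rewrite geq_max sf.
  move=> c f [? sf]; split; last by apply: leq_trans (size_scale_leq _ _) _.
  by rewrite -mul_polyC; exact: iZ.
have [lS [lS1 lS2]] : fin_gen S.
  apply: (noetherian_fin_gen (l := [seq 'X^i | i <- iota 0 d])) => //.
  move=> f [_ sf] T hT hl; rewrite -(coefK f) poly_def.
  apply: submodule_sum => // i _; case: (hT) => _ _; apply.
  apply: hl; apply: map_f; rewrite mem_iota add0n.
  exact: leq_trans (ltn_ord i) sf.
have /choice[F hF] : forall a : R, exists f : {poly R},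
    a \in lL -> [/\ I f, (size f <= d.+1)%N & f`_d = a].
  move=> a; case: (boolP (a \in lL)) => [/hd[f]|_]; last by exists 0.
  by exists f.
exists ([seq F a | a <- lL] ++ lS); split.
  move=> v; rewrite mem_cat => /orP[/mapP[a /hF[? _ _] ->]//|/lS1[]//].
move=> T hT hl f If; have [t0 tD tZ] := hT.
have [n] := ubnP (size f); elim: n f If => // n IH f If /ltnSE sf.
have [sd|sd] := leqP (size f) d.
  apply: (lS2 f _ T) => [//||v hv]; last by apply: hl; rewrite mem_cat hv orbT.
  by split=> // c g; rewrite -mul_polyC; exact: tZ.
case sfE : (size f) sd => [//|e] sd; rewrite ltnS in sd.
have Le : (\bigcup_d L d) f`_e by exists e => //; exists f; rewrite sfE.
case: (lL2 [set c | exists h : {poly R},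
  [/\ I h, T h, (size h <= d.+1)%N & h`_d = c]] _ _ _ Le).
- split.
  + by exists 0; rewrite size_poly0 coef0; split.
  + move=> _ _ [g [Ig Tg sg <-]] [h [Ih Th sh <-]]; exists (g + h).
    rewrite coefD; split=> //; [exact: iD|exact: tD|].
    by apply: leq_trans (size_polyD _ _) _; rewrite geq_max sg.
  + move=> c _ [g [Ig Tg sg <-]]; exists (c%:P * g).
    rewrite coefCM; split=> //; [exact: iZ|exact: tZ|].
    by rewrite mul_polyC; apply: leq_trans (size_scale_leq _ _) _.
- move=> a ha; have [? ? ?] := hF a ha; exists (F a); split=> //.
  by apply: hl; rewrite mem_cat; apply/orP; left; exact: map_f.
move=> h [Ih Th sh hc].
rewrite -[f](subrK ('X^(e - d) * h)); apply: tD; last exact: tZ.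
apply: IH.
  by apply: iD => //; rewrite -mulN1r; apply/iZ/iX.
apply: leq_trans sf; rewrite sfE ltnS.
apply/leq_sizeP => j; rewrite leq_eqVlt coefB coefXnM => /orP[/eqP<-|lt].
  by rewrite ltnNge leq_subr /= subKn ?hc ?subrr.
rewrite nth_default ?sfE // ltnNge (leq_trans (leq_subr _ _) (ltnW lt)) /=.
rewrite sub0r (nth_default _ (leq_trans sh _)) ?oppr0 //.
by rewrite ltn_subRL subnK.
Qed.

(** * Ring morphisms and finite type algebras *)

Lemma rmorphism_exists (A B : pzRingType) (f : A -> B) :
    (forall x y, f (x + y) = f x + f y) -> (forall x y, f (x * y) = f x * f y) ->
  f 1 = 1 -> exists g : {rmorphism A -> B}, g =1 f.
Proof.
move=> fD fM f1.
have fB : zmod_morphism f.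
  move=> x y; apply: (addIr (f y)).
  by rewrite -fD !subrK.
pose m1 := GRing.isZmodMorphism.Build A B f fB.
pose m2 := GRing.isMonoidMorphism.Build A B f (f1, fM).
by exists (HB.pack_for {rmorphism A -> B} f m1 m2).
Qed.

Lemma rmorphism_inverse (A B : pzRingType) (f : {rmorphism A -> B}) :
    injective f -> (forall b, exists a, f a = b) ->
  exists g : {rmorphism B -> A}, cancel f g /\ cancel g f.
Proof.
move=> inj surj; have [g gK] := choice surj.
have [||| h hE] := @rmorphism_exists B A g.
- by move=> x y; apply: inj; rewrite rmorphD !gK.
- by move=> x y; apply: inj; rewrite rmorphM !gK.
- by apply: inj; rewrite rmorph1 gK.
by exists h; split=> x; rewrite hE ?gK //; apply: inj; rewrite gK.
Qed.

Lemma rmorphism_factor (A B C : pzRingType) (f : {rmorphism A -> C})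
    (pi : {rmorphism A -> B}) :
    (forall b, exists a, pi a = b) -> (forall a, pi a = 0 -> f a = 0) ->
  exists g : {rmorphism B -> C}, forall a, g (pi a) = f a.
Proof.
move=> surj ker; have [s sK] := choice surj.
have fs a : f (s (pi a)) = f a.
  by apply/eqP; rewrite -subr_eq0 -rmorphB; apply/eqP/ker; rewrite rmorphB sK subrr.
have [||| h hE] := @rmorphism_exists B C (f \o s).
- by move=> x y /=; rewrite -rmorphD -[RHS]fs rmorphD !sK.
- by move=> x y /=; rewrite -rmorphM -[RHS]fs rmorphM !sK.
- by rewrite /= -[in LHS](rmorph1 pi) fs rmorph1.
by exists h => a; rewrite hE /= fs.
Qed.

Lemma noetherian_surj (R S : pzRingType) (phi : {rmorphism R -> S}) :
  noetherian R -> (forall b, exists a, phi a = b) -> noetherian S.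
Proof.
move=> nR surj I [i0 iD iZ].
have [|l [l1 l2]] := nR (phi @^-1` I).
  split; first by rewrite /= rmorph0.
    by move=> x y hx hy; rewrite /= rmorphD; apply: iD.
  by move=> a x hx; rewrite /= rmorphM; apply: iZ.
exists (map phi l); split.
  by move=> _ /mapP[a /l1 ? ->].
move=> J [j0 jD jZ] hl b; have [a <-] := surj b => Ib.
apply: (l2 (phi @^-1` J)) => //.
  split; first by rewrite /= rmorph0.
    by move=> x y hx hy; rewrite /= rmorphD; apply: jD.
  by move=> c x hx; rewrite /= rmorphM; apply: jZ.
by move=> c hc; apply: hl; exact: map_f.
Qed.

(** Adjoining one generator replaces the base ring by its polynomial ring. *)
Lemma noetherian_finite_type (R S : comNzRingType) (phi : {rmorphism R -> S}) :
  noetherian R -> finite_type phi -> noetherian S.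
Proof.
move=> nR [n [b hb]]; elim: n R phi nR b hb => [|n IH] R phi nR b hb.
  apply: (noetherian_surj (phi := phi)) => // x.
  apply: (hb [set y | exists a, phi a = y]) => [a|[]//|_ _ [a <-] [c <-]|_ _ [a <-] [c <-]].
  - by exists a.
  - by exists (a + c); rewrite rmorphD.
  - by exists (a * c); rewrite rmorphM.
have com : commr_rmorph phi (b ord0) by move=> x; exact: mulrC.
apply: (IH _ (horner_morph com) (noetherian_poly nR) (b \o lift ord0)).
move=> T Tphi Tb TD TM x; apply: hb => // [a|i].
  by rewrite -(horner_morphC com); apply: Tphi.
have [j ->|->] := unliftP ord0 i; first exact: Tb.
by rewrite -(horner_morphX com); apply: Tphi.
Qed.

Lemma noetherian_field (k : fieldType) : noetherian k.
Proof.
move=> I [i0 iD iZ]; have [[a Ia a0]|no] := pselect (exists2 a, I a & a != 0).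
  exists [:: 1]; split.
    by move=> b; rewrite inE => /eqP->; rewrite -(mulVf a0); apply: iZ.
  move=> J [_ _ jZ] hl b _; rewrite -[b]mulr1; apply/jZ/hl; exact: mem_head.
exists [::]; split=> // J [j0 _ _] _ a Ia.
by have [->//|a0] := eqVneq a 0; case: no; exists a.
Qed.

(** * Infinitesimal lifting along nilpotent kernels *)

Section PrincipalQuotient.
Variables (C : comNzRingType) (w : C) (ww : w * w = 0).

(** The proof that [w] squares to zero is an argument because it makes the
    ideal proper, as the quotient construction requires. *)
Definition principal of w * w = 0 : C -> bool := fun c => `[< exists a, c = a * w >].

Lemma principal_closed : idealr_closed (principal ww).
Proof.
split.
- by apply/asboolP; exists 0; rewrite mul0r.
- apply/asboolP => -[a e]; have : 1 = 0 :> C by rewrite -[1]mulr1 e mulrACA ww mulr0.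
  by apply/eqP; exact: oner_neq0.
move=> a _ _ /asboolP[b ->] /asboolP[c ->]; apply/asboolP; exists (a * b + c).
by rewrite mulrDl mulrA.
Qed.

Definition principal_idealr : idealr C :=
  HB.pack_for (idealr C) (principal ww) (isIdealr.Build C (principal ww) principal_closed).

Lemma principal_quotient : exists (D : comNzRingType) (pi : {rmorphism C -> D}),
  (forall d, exists c, pi c = d) /\ forall c, pi c = 0 <-> exists a, c = a * w.
Proof.
exists (Quotient.quot principal_idealr), (\pi_(Quotient.quot principal_idealr))%qT.
split=> [d|c]; first by exists (repr d); exact: reprK.
have := Quotient.idealrBE principal_idealr c 0; rewrite subr0 => e.
split=> [h|[a ca]].
  by apply/asboolP; rewrite -[`[< _ >]]/(c \in principal_idealr) e h -(rmorph0 (\pi_(Quotient.quot principal_idealr))%qT).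
rewrite -(rmorph0 (\pi_(Quotient.quot principal_idealr))%qT); apply/eqP; rewrite -e.
by apply/asboolP; exists a.
Qed.

End PrincipalQuotient.

(** The kernel is generated by the [z] with [z ^+ e.+1 = 0] for [(z, e)] in [l].
    If [e > 0] then [z ^+ e] squares to zero; lift first to the quotient by it, in
    which the exponent of [z] has dropped, and then along the square-zero
    quotient map. *)
Lemma formally_etale_lift_nil (A B : comPzRingType) (phi : {rmorphism A -> B})
    (C : comNzRingType) (D : comPzRingType) (pi : {rmorphism C -> D})
    (l : seq (C * nat)) (f : {rmorphism A -> C}) (g : {rmorphism B -> D}) :
    formally_etale phi -> (forall d, exists c, pi c = d) ->
    (forall ze, ze \in l -> pi ze.1 = 0 /\ ze.1 ^+ ze.2.+1 = 0) ->
    (forall J, ideal J -> (forall ze, ze \in l -> J ze.1) -> forall c, pi c = 0 -> J c) ->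
    (forall a, pi (f a) = g (phi a)) ->
  exists h : {rmorphism B -> C}, (forall a, h (phi a) = f a) /\ forall b, pi (h b) = g b.
Proof.
move=> fe; have [n] := ubnP (\sum_(ze <- l) ze.2.+1)%N.
elim: n C pi l f => // n IH C pi l f /ltnSE ln surj hl ker fg.
case: l ln hl ker => [|[z [|e]] l] ln hl ker.
- have k0 c : pi c = 0 -> c = 0.
    apply: (ker [set 0]) => //; split=> // [x y /= -> ->|a x /= ->];
      by rewrite ?addr0 ?mulr0.
  have [|h [h1 h2 _]] := fe _ _ pi surj _ f g fg; last by exists h.
  by move=> c c' /k0-> _; rewrite mul0r.
- have [_] := hl (z, 0%N) (mem_head _ _); rewrite /= expr1 => z0.
  apply: (IH C pi l) => //.
  + by apply: leq_trans ln; rewrite big_cons add1n.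
  + by move=> ze hze; apply: hl; rewrite inE hze orbT.
  + move=> J hJ hJl; apply: ker => // ze; rewrite inE => /orP[/eqP->/=|]; last exact: hJl.
    by rewrite z0; case: hJ.
have [piz ze] := hl (z, e.+1) (mem_head _ _).
rewrite /= in piz ze; pose w := z ^+ e.+1.
have ww : w * w = 0 by rewrite /w -exprD addSnnS addnC exprD ze mul0r.
have [C' [q [qsurj qker]]] := principal_quotient ww.
have [|pi' pi'E] := @rmorphism_factor _ _ _ pi q qsurj.
  by move=> a /qker[c ->]; rewrite rmorphM rmorphXn /= piz exprS mul0r mulr0.
have [|||||h [h1 h2]] := IH C' pi' ((q z, e) :: [seq (q ze.1, ze.2) | ze <- l]) (q \o f).
- by apply: leq_trans ln; rewrite !big_cons big_map.
- by move=> d; have [c <-] := surj d; exists (q c).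
- move=> ze'; rewrite inE => /orP[/eqP->|/mapP[y yl ->]] /=.
    rewrite pi'E piz -rmorphXn; split=> //; apply/qker; exists 1.
    by rewrite mul1r.
  have [|h1 h2] := hl y; first by rewrite inE yl orbT.
  by rewrite pi'E -rmorphXn h2 rmorph0.
- move=> J [j0 jD jM] hJ c'; have [c <-] := qsurj c'; rewrite pi'E => pic.
  apply: (ker (q @^-1` J)) => //.
    split; first by rewrite /= rmorph0.
      by move=> x y ? ?; rewrite /= rmorphD; exact: jD.
    by move=> a x ?; rewrite /= rmorphM; exact: jM.
  move=> y; rewrite inE => /orP[/eqP->|yl] /=.
    by apply: (hJ (q z, e)); exact: mem_head.
  by apply: (hJ (q y.1, y.2)); rewrite inE; apply/orP; right; apply/mapP; exists y.
- by move=> a /=; rewrite pi'E.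
have [||h' [h'1 h'2 _]] := fe _ _ q qsurj _ f h.
- by move=> c c' /qker[a ->] /qker[b ->]; rewrite mulrACA ww mulr0.
- by move=> a; rewrite h1.
by exists h'; split=> // b; rewrite -pi'E h'2 h2.
Qed.

(** * Adjoining roots and the Frobenius basis of an étale algebra *)

Lemma exprD_char (p r : nat) (A : comPzRingType) (x y : A) :
  prime p -> p%:R = 0 :> A -> (x + y) ^+ (p ^ r) = x ^+ (p ^ r) + y ^+ (p ^ r).
Proof.
move=> pr_p p0; elim: r => [|r IH]; first by rewrite expn0 !expr1.
rewrite expnSr !exprM {}IH; move: (x ^+ _) (y ^+ _) => {}x {}y.
rewrite exprDn; case: p pr_p p0 => // p pr_p p0.
rewrite big_ord_recl big_ord_recr /= subn0 subnn expr0 mulr1 bin0 mulr1n.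
rewrite binn mulr1n mul1r big1 ?add0r // => i _.
rewrite -mulr_natr.
have /dvdnP[c ->] : (p.+1 %| 'C(p.+1, bump 0 i))%N.
  by apply: prime_dvd_bin => //; rewrite /bump add1n /= ltnS.
by rewrite natrM p0 !mulr0.
Qed.

Section Frobenius.
Variables (p r : nat) (pr_p : prime p).
Local Notation q := (p ^ r)%N.

Lemma frob_gt0 : (0 < q)%N.
Proof. by rewrite expn_gt0 prime_gt0. Qed.

Lemma frob_rmorphism (A : comPzRingType) : p%:R = 0 :> A ->
  exists F : {rmorphism A -> A}, forall a, F a = a ^+ q.
Proof.
move=> p0; apply: rmorphism_exists => [x y|x y|]; last exact: expr1n.
- exact: exprD_char.
- exact: exprMn.
Qed.

Lemma expr_sum_char (A : comPzRingType) (I : Type) (s : seq I) (P : pred I) (F : I -> A) :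
  p%:R = 0 :> A ->
  (\sum_(i <- s | P i) F i) ^+ q = \sum_(i <- s | P i) F i ^+ q.
Proof.
move=> p0; have [f fE] := frob_rmorphism p0.
by rewrite -fE rmorph_sum; apply: eq_bigr => i _; rewrite fE.
Qed.

Lemma rmorph_natr_eq0 (A B : pzRingType) (f : {rmorphism A -> B}) :
  p%:R = 0 :> A -> p%:R = 0 :> B.
Proof. by move=> p0; rewrite -(rmorph_nat f) p0 rmorph0. Qed.

End Frobenius.

Section RootRing.
Variables (p r : nat) (pr_p : prime p) (r_gt0 : (0 < r)%N).
Local Notation q := (p ^ r)%N.

Lemma frob_gt1 : (1 < q)%N.
Proof. by rewrite -(exp1n r) ltn_exp2r // prime_gt1. Qed.

(** [C] is obtained from [B] by adjoining [q]-th roots: the maps [rho] and [iota]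
    compose to the [q]-th power map on either side, and [t] generates [C] over
    [B] with additive, [B]-homogeneous coordinates [kappa]. *)
Definition root_ring (B C : comNzRingType) (iota : {rmorphism B -> C})
    (rho : {rmorphism C -> B}) (I : finType) (kappa : I -> C -> B) (t : I -> C) :=
  [/\ forall b, rho (iota b) = b ^+ q, forall z, iota (rho z) = z ^+ q,
      forall i z z', kappa i (z + z') = kappa i z + kappa i z',
      forall i b z, kappa i (iota b * z) = b * kappa i z
    & forall z, z = \sum_i iota (kappa i z) * t i].

Section Step.
Variables (B C : comNzRingType) (iota : {rmorphism B -> C})
  (rho : {rmorphism C -> B}) (I : finType) (kappa : I -> C -> B) (t : I -> C).
Hypotheses (p0 : p%:R = 0 :> B) (rr : root_ring iota rho kappa t).
Variable x : B.

Let h : {poly C} := 'X^q - (iota x)%:P.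

Let sz : size h = q.+1.
Proof. by rewrite size_XnsubC // ltnW // frob_gt1. Qed.

Let mh : mk_monic h = h.
Proof. by rewrite /mk_monic sz ltnS ltnW ?frob_gt1 // monicXnsubC // ltnW ?frob_gt1. Qed.

Let com : commr_rmorph rho x.
Proof. by move=> z; exact: mulrC. Qed.

Let evh : horner_morph com h = 0.
Proof.
case: rr => ri _ _ _ _.
by rewrite rmorphB rmorphXn /= horner_morphX horner_morphC ri subrr.
Qed.

Let ev_mod (u : {poly C}) : horner_morph com (rmodp u (mk_monic h)) = horner_morph com u.
Proof.
rewrite [u in RHS](rdivp_eq (monic_mk_monic h)).
by rewrite rmorphD rmorphM /= mh evh mulr0 add0r.
Qed.

(** Adjoin to [C] a root of ['X^q - iota x]; [rho] sends it to [x]. *)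
Lemma root_ring_step : exists (C' : comNzRingType) (iota' : {rmorphism B -> C'})
    (rho' : {rmorphism C' -> B}) (I' : finType) (kappa' : I' -> C' -> B) (t' : I' -> C'),
  [/\ root_ring iota' rho' kappa' t', exists z, rho' z = x
    & forall b, (exists z, rho z = b) -> exists z, rho' z = b].
Proof.
case: rr => ri ir kD kM kE.
pose C' : comNzRingType := {poly %/ h}.
have [rho' rhoE] : exists rho' : {rmorphism C' -> B}, forall u : C', rho' u = horner_morph com (val u).
  apply: rmorphism_exists => [u v|u v|].
  - by rewrite -rmorphD.
  - by rewrite /= ev_mod rmorphM.
  - exact: rmorph1.
have [e eP] : exists e : {rmorphism C -> C'}, forall c, e c = in_qpoly h c%:P.
  by exists (in_qpoly h \o polyC).
have eE c : val (e c) = c%:P.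
  rewrite eP /= rmodp_small // size_polyC mh sz ltnS.
  exact: leq_trans (leq_b1 _) (frob_gt0 _ _).
have re c : rho' (e c) = rho c by rewrite rhoE eE horner_morphC.
pose X : C' := in_qpoly h 'X.
have rX : rho' X = x by rewrite rhoE /= ev_mod horner_morphX.
have Xq : X ^+ q = e (iota x).
  rewrite /X eP -rmorphXn; apply/eqP; rewrite -subr_eq0 -rmorphB /=; apply/eqP/val_inj.
  rewrite /= -/h mh rmodpp //.
  by rewrite monicXnsubC // ltnW // frob_gt1.
have qE (u : C') : u = in_qpoly h (val u).
  by apply: val_inj; rewrite /= rmodp_small // size_mk_monic.
have uE (u : C') : u = \sum_(j < q) e (val u)`_j * X ^+ j.
  rewrite [LHS]qE; rewrite -[val u in LHS]coefK poly_def.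
  rewrite (big_ord_widen q (fun j => (val u)`_j *: 'X^j)); last first.
    by rewrite -ltnS; apply: leq_trans (size_mk_monic u) _; rewrite mh sz.
  rewrite big_mkcond rmorph_sum; apply: eq_bigr => j _.
  case: ltnP => [_|ge]; first by rewrite -mul_polyC rmorphM rmorphXn eP.
  by rewrite nth_default // !rmorph0 mul0r.
have eM c (u : C') : val (e c * u) = c *: val u.
  transitivity (rmodp (val (e c) * val u) (mk_monic h)); first by [].
  rewrite eE mul_polyC rmodp_small //.
  exact: leq_ltn_trans (size_scale_leq _ _) (size_mk_monic u).
have p0' : p%:R = 0 :> C' by exact: (rmorph_natr_eq0 (e \o iota) p0).
exists C', (e \o iota), rho', ('I_q * I)%type,
  (fun (ji : 'I_q * I) (u : C') => kappa ji.2 (val u)`_ji.1), (fun ji : 'I_q * I => X ^+ ji.1 * e (t ji.2)).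
split; last 2 first.
- by exists X.
- by move=> b [z <-]; exists (e z); rewrite re.
split=> [b|z|[j i] z z'|[j i] b z|z] /=.
- by rewrite re ri.
- have -> : rho' z = \sum_(j < q) rho (val z)`_j * x ^+ j.
    rewrite [in LHS](uE z) rmorph_sum; apply: eq_bigr => j _.
    by rewrite rmorphM rmorphXn /= re rX.
  rewrite [in RHS](uE z) (expr_sum_char _ pr_p) // !rmorph_sum.
  apply: eq_bigr => j _; rewrite exprMn -exprM mulnC exprM Xq -!rmorphXn -ir -rmorphM.
  by rewrite !rmorphM !rmorphXn.
- by rewrite coefD kD.
- have := congr1 (fun f : {poly C} => f`_j) (eM (iota b) z).
  by rewrite coefZ /= => ->; exact: kM.
- rewrite [LHS](uE z) -(pair_big xpredT xpredT (fun (j : 'I_q) (i : I) => e (iota (kappa i (val z)`_j)) * (X ^+ j * e (t i)))) /=.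
  apply: eq_bigr => j _; rewrite [(val z)`_j in LHS]kE rmorph_sum mulr_suml.
  by apply: eq_bigr => i _; rewrite rmorphM mulrAC mulrA.
Qed.
End Step.
End RootRing.

Section FrobeniusBasis.
Variables (p r : nat) (pr_p : prime p) (r_gt0 : (0 < r)%N).
Local Notation q := (p ^ r)%N.

Lemma root_ring_adjoin (B : comNzRingType) (p0 : p%:R = 0 :> B) (l : seq B) :
  exists (C : comNzRingType) (iota : {rmorphism B -> C}) (rho : {rmorphism C -> B})
    (I : finType) (kappa : I -> C -> B) (t : I -> C),
    root_ring p r iota rho kappa t /\ forall x, x \in l -> exists z, rho z = x.
Proof.
elim: l => [|x l [C [iota [rho [I [kappa [t [rr hl]]]]]]]].
  have [F FE] := frob_rmorphism r pr_p p0.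
  exists B, idfun, F, unit, (fun _ => id), (fun=> 1); split=> //; split=> //.
  by move=> z; rewrite sumr_const card_unit mulr1.
have [C' [iota' [rho' [I' [kappa' [t' [rr' hx h]]]]]]] :=
  root_ring_step pr_p r_gt0 p0 rr x.
exists C', iota', rho', I', kappa', t'; split=> // y.
by rewrite inE => /orP[/eqP->//|/hl/h].
Qed.

Lemma closed_field_perfect (k : closedFieldType) : p%:R = 0 :> k ->
  exists R : {rmorphism k -> k}, forall c, R c ^+ q = c.
Proof.
move=> p0; have [F FE] := frob_rmorphism r pr_p p0.
have [||R [_ RK]] := rmorphism_inverse (f := F); first exact: fmorph_inj.
  move=> c; have /closed_rootP[x] : size ('X^q - c%:P : {poly k}) != 1%N.
    by rewrite size_XnsubC ?expn_gt0 ?prime_gt0 // eqSS -lt0n expn_gt0 prime_gt0.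
  rewrite /root !hornerE subr_eq0 => /eqP e; exists x.
  by rewrite FE.
by exists R => c; rewrite -FE RK.
Qed.

(** Take [C] with roots of ['X] and of the ring generators of [B].  As [k] is
    perfect, [rho] maps [C] onto [B], and its kernel consists of elements [z]
    with [z ^+ q = iota (rho z) = 0].  Let [h] be the section of [rho] obtained
    by lifting the identity of [B].  The coordinates of [h] have the required
    homogeneity because [h (c ^+ q) = h c ^+ q = iota (rho (h c)) = iota c]. *)
Lemma etale_frobenius_basis (k : closedFieldType) (B : comNzRingType)
    (phi : {rmorphism {poly k} -> B}) : p%:R = 0 :> k -> etale_ring phi ->
  noetherian B /\ exists (I : finType) (kappa : I -> B -> B) (t : I -> B),
    [/\ forall i b c, kappa i (b + c) = kappa i b + kappa i c,
        forall i c b, kappa i (c ^+ q * b) = c * kappa i b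
      & forall b, b = \sum_i kappa i b ^+ q * t i].
Proof.
move=> p0 [ft fe].
have nB : noetherian B.
  exact: noetherian_finite_type (noetherian_poly (@noetherian_field k)) ft.
have p0B : p%:R = 0 :> B by exact: (rmorph_natr_eq0 (phi \o polyC) p0).
have [R RE] := closed_field_perfect p0.
have [n [b hb]] := ft.
have [C [iota [rho [I [kappa [t [rr hl]]]]]]] :=
  root_ring_adjoin p0B (phi 'X :: codom b).
have [ri ir kD kM kE] := rr.
(* T is the formal q-th root of the coordinate of the affine line *)
have [T rT] := hl _ (mem_head _ _).
have rsurj x : exists z, rho z = x.
  apply: (hb [set x | exists z, rho z = x]) => [f|i|_ _ [y <-] [z <-]|_ _ [y <-] [z <-]].
  - elim/poly_ind: f => [|f c [z zE]]; first by exists 0; rewrite !rmorph0.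
    exists (z * T + iota (phi (R c)%:P)).
    by rewrite !rmorphD !rmorphM /= zE rT ri -rmorphXn -polyC_exp RE.
  - by apply: hl; rewrite inE codom_f orbT.
  - by exists (y + z); rewrite rmorphD.
  - by exists (y * z); rewrite rmorphM.
have nC : noetherian C.
  apply: (noetherian_finite_type (phi := iota)) => //.
  exists #|I|, (t \o enum_val) => S Sio St SD SM z.
  rewrite [z]kE; elim/big_ind: _ => [||i _]; first by rewrite -(rmorph0 iota).
    exact: SD.
  by apply: SM => //; rewrite -(enum_rankK i); exact: St.
have [|l [l1 l2]] := nC [set z | rho z = 0].
  split=> /= [|x y hx hy|a x hx]; first exact: rmorph0.
    by rewrite rmorphD hx hy addr0.
  by rewrite rmorphM hx mulr0.
(* C is an algebra over k[t] through the q-th roots of scalars and T, so that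
   rho is a map of algebras *)
have com : commr_rmorph (iota \o phi \o polyC \o R) T by move=> x; exact: mulrC.
have [|||h [_ rh]] := formally_etale_lift_nil (pi := rho)
   (l := [seq (z, q.-1) | z <- l]) (f := horner_morph com) (g := idfun) fe rsurj.
- move=> ze /mapP[z zl ->] /=; rewrite (l1 z zl) prednK ?frob_gt0 //; split=> //.
  by rewrite -ir (l1 z zl) rmorph0.
- move=> J hJ hlJ c rc; apply: l2 rc => // z zl.
  by apply: (hlJ (z, q.-1)); apply: map_f.
- move=> f /=; elim/poly_ind: f => [|f c IH]; first by rewrite !rmorph0.
  rewrite !rmorphD !rmorphM /= IH horner_morphX rT horner_morphC /=.
  by rewrite ri -rmorphXn -polyC_exp RE.
split=> //; exists I, (fun i x => kappa i (h x)), (fun i => rho (t i)).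
split=> [i x y|i c x|x].
- by rewrite rmorphD kD.
- by rewrite rmorphM rmorphXn -ir rh kM.
- rewrite -[LHS]rh [in LHS](kE (h x)) rmorph_sum; apply: eq_bigr => i _.
  by rewrite rmorphM ri.
Qed.

(** The form needed for rings of sections, whose nontriviality is a fact and not
    part of their type. *)
Lemma etale_frobenius_basis_pz (k : closedFieldType) (B : comPzRingType)
    (phi : {rmorphism {poly k} -> B}) :
  (1 : B) != 0 -> p%:R = 0 :> k -> etale_ring phi ->
  noetherian B /\ exists (I : finType) (kappa : I -> B -> B) (t : I -> B),
    [/\ forall i b c, kappa i (b + c) = kappa i b + kappa i c,
        forall i c b, kappa i (c ^+ q * b) = c * kappa i b
      & forall b, b = \sum_i kappa i b ^+ q * t i].
Proof.
move=> nz; pose B' : comNzRingType :=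
  HB.pack_for comNzRingType B (GRing.PzSemiRing_isNonZero.Build B nz).
exact: (@etale_frobenius_basis k B' phi).
Qed.

End FrobeniusBasis.

(** * Base change of modules *)

Section Submodule.
Variables (A : pzRingType) (V : lmodType A) (S : set V).

Definition sub_pred of submodule S : V -> bool := fun x => `[< S x >].

Lemma sub_pred_closed (hS : submodule S) : submod_closed (sub_pred hS).
Proof.
have [s0 sD sZ] := hS; split; first exact/asboolP.
by move=> a x y /asboolP Sx /asboolP Sy; apply/asboolP; apply: sD => //; exact: sZ.
Qed.

HB.instance Definition _ (hS : submodule S) :=
  GRing.isSubmodClosed.Build A V (sub_pred hS) (sub_pred_closed hS).

Record sub_module (hS : submodule S) := SubModule {
  sub_module_val :> V;
  sub_module_valP : sub_module_val \in sub_pred hS }.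

HB.instance Definition _ (hS : submodule S) := [isSub for @sub_module_val hS].
HB.instance Definition _ (hS : submodule S) := [Choice of sub_module hS by <:].
HB.instance Definition _ (hS : submodule S) :=
  [SubChoice_isSubLmodule of sub_module hS by <:].
End Submodule.

Definition restrict_scalars (A B : pzRingType) (v : {rmorphism A -> B})
  (P : lmodType B) : Type := P.

Section RestrictScalars.
Variables (A B : pzRingType) (v : {rmorphism A -> B}) (P : lmodType B).
Local Notation Q := (restrict_scalars v P).
HB.instance Definition _ := GRing.Zmodule.on Q.
Let scale (a : A) (x : Q) : Q := v a *: (x : P).
Fact restrict_scaleA a b x : scale a (scale b x) = scale (a * b) x.
Proof. by rewrite /scale scalerA rmorphM. Qed.
Fact restrict_scale1 : left_id 1 scale.
Proof. by move=> x; rewrite /scale rmorph1 scale1r. Qed.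
Fact restrict_scaleDr : right_distributive scale +%R.
Proof. by move=> a x y; rewrite /scale scalerDr. Qed.
Fact restrict_scaleDl x : {morph scale^~ x : a b / a + b}.
Proof. by move=> a b; rewrite /scale rmorphD scalerDl. Qed.
HB.instance Definition _ := GRing.Zmodule_isLmodule.Build A Q
  restrict_scaleA restrict_scale1 restrict_scaleDr restrict_scaleDl.
End RestrictScalars.

Section Linear.
Variables (A : pzRingType) (V W : lmodType A).

Lemma linear_exists (f : V -> W) : (forall x y, f (x + y) = f x + f y) ->
  (forall a x, f (a *: x) = a *: f x) -> exists g : {linear V -> W}, g =1 f.
Proof.
move=> fD fZ; have fl : linear f by move=> a x y; rewrite fD fZ.
by exists (HB.pack_for {linear V -> W} f (GRing.isLinear.Build A V W *:%R f fl)).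
Qed.

Lemma linear_ext (f g : {linear V -> W}) : f =1 g -> f = g.
Proof.
case: f g => [f cf] [g cg] /= /funext e; subst g; congr GRing.Linear.Pack.
case: cf cg => [[a] [b]] [[a'] [b']].
by rewrite (Prop_irrelevance a a') (Prop_irrelevance b b').
Qed.
End Linear.

Lemma semilinear0 (A B : comPzRingType) (phi : A -> B) (M : lmodType A)
  (N : lmodType B) (f : M -> N) : semilinear_map phi f -> f 0 = 0.
Proof. by case=> fD _; apply: (addIr (f 0)); rewrite -fD !add0r. Qed.

Lemma semilinear_sum (A B : comPzRingType) (phi : A -> B) (M : lmodType A)
    (N : lmodType B) (f : M -> N) (I : Type) (r : seq I) (P : pred I)
    (a : I -> A) (x : I -> M) : semilinear_map phi f ->
  f (\sum_(i <- r | P i) a i *: x i) = \sum_(i <- r | P i) phi (a i) *: f (x i).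
Proof.
move=> fs; have f0 := semilinear0 fs; case: fs => fD fZ.
elim: r => [|i r IH]; first by rewrite !big_nil.
by rewrite !big_cons; case: ifP => // _; rewrite fD fZ IH.
Qed.

Section BaseChange.
Variables (A B : comPzRingType) (phi : A -> B) (M : lmodType A)
  (N : lmodType B) (i : M -> N) (bc : is_base_change phi i).

(** Corestrict [i] to the submodule [S]: the universal property gives a
    linear map from [N] to [S] whose composite with the inclusion fixes all
    [i m], hence is the identity. *)
Lemma base_change_span (S : set N) : submodule S -> (forall m, S (i m)) -> forall x, S x.
Proof.
move=> hS hi x; have [[iD iZ] univ] := bc.
have mem m : i m \in sub_pred hS by apply/asboolP.
have [|g [gE _]] := univ (sub_module hS) (fun m => SubModule (mem m)).
  by split=> [m m'|a m]; apply: val_inj; rewrite /= ?iD ?iZ.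
have [|u [uE u_uniq]] := univ N i; first by split.
have [||j jE] := @linear_exists B N N (fun x => val (g x)).
- by move=> y z; rewrite linearD.
- by move=> a z; rewrite linearZ.
have e : j =1 idfun.
  by move=> y; rewrite (u_uniq j) ?(u_uniq idfun) // => m; rewrite jE gE.
by rewrite -[x]e jE; exact/asboolP/(valP (g x)).
Qed.

Lemma base_change_ext (C : comPzRingType) (P : lmodType C) (theta : B -> C)
    (f g : N -> P) : semilinear_map theta f -> semilinear_map theta g ->
  (forall m, f (i m) = g (i m)) -> f =1 g.
Proof.
move=> fs gs fg; apply: (base_change_span (S := [set x | f x = g x])) => //.
have [[fD fZ] [gD gZ]] := (fs, gs); split=> /=.
- by rewrite (semilinear0 fs) (semilinear0 gs).
- by move=> x y; rewrite fD gD => -> ->.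
- by move=> a x; rewrite fZ gZ => ->.
Qed.
End BaseChange.

(** * Unit modules over a ring with a Frobenius basis *)

Section Coinduced.
Variables (A : comPzRingType) (M : lmodType A).

(** The additive maps from [A] to [M], with [A] acting on the source, receive the
    Frobenius-semilinear map sending [m] to [fun a => kappa_s a *: m].  This is
    where the universal property of a unit module is tested. *)
Definition additive_pred : (A -> M) -> bool :=
  fun g => `[< forall x y, g (x + y) = g x + g y >].

Lemma additive_pred_closed : zmod_closed additive_pred.
Proof.
split; first by apply/asboolP => x y; rewrite addr0.
move=> f g /asboolP fD /asboolP gD; apply/asboolP => x y.
rewrite -[LHS]/(f (x + y) - g (x + y)) -[RHS]/((f x - g x) + (f y - g y)).
by rewrite fD gD opprD addrACA.
Qed.
HB.instance Definition _ :=
  GRing.isZmodClosed.Build (A -> M) additive_pred additive_pred_closed.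

Record coinduced := Coinduced {
  coinduced_fun :> A -> M;
  coinducedP : coinduced_fun \in additive_pred }.
HB.instance Definition _ := [isSub for coinduced_fun].
HB.instance Definition _ := [Choice of coinduced by <:].
HB.instance Definition _ := [SubChoice_isSubZmodule of coinduced by <:].

Lemma coinducedD (g : coinduced) x y : g (x + y) = g x + g y.
Proof. by case: g => g /= /asboolP. Qed.

Lemma coinduced_scaleP a (g : coinduced) : (fun x => g (x * a)) \in additive_pred.
Proof. by apply/asboolP => x y; rewrite mulrDl coinducedD. Qed.

Let scale a g := Coinduced (coinduced_scaleP a g).

Fact coinduced_scaleA a b g : scale a (scale b g) = scale (a * b) g.
Proof.
by apply: val_inj; apply/funext => x /=; rewrite -mulrA.
Qed.
Fact coinduced_scale1 : left_id 1 scale.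
Proof. by move=> g; apply: val_inj; apply/funext => x /=; rewrite mulr1. Qed.
Fact coinduced_scaleDr : right_distributive scale +%R.
Proof. by move=> a f g; apply: val_inj; apply/funext => x. Qed.
Fact coinduced_scaleDl g : {morph scale^~ g : a b / a + b}.
Proof.
by move=> a b; apply: val_inj; apply/funext => x /=; rewrite mulrDr coinducedD.
Qed.
HB.instance Definition _ := GRing.Zmodule_isLmodule.Build A coinduced
  coinduced_scaleA coinduced_scale1 coinduced_scaleDr coinduced_scaleDl.

Lemma coinduced_sumE (I : Type) (r : seq I) (P : pred I) (g : I -> coinduced) x :
  (\sum_(i <- r | P i) g i) x = \sum_(i <- r | P i) g i x.
Proof. by elim/big_rec2: _ => // i y z _ <-. Qed.
End Coinduced.

Section UnitModule.
Variables (A : comPzRingType) (q : nat).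
Variables (I : finType) (kappa : I -> A -> A) (t : I -> A).
Hypotheses (kD : forall i a b, kappa i (a + b) = kappa i a + kappa i b)
  (kM : forall i c a, kappa i (c ^+ q * a) = c * kappa i a)
  (kE : forall a, a = \sum_i kappa i a ^+ q * t i).

Section Relation.
Variables (M : lmodType A) (F : M -> M).
Hypothesis uF : is_base_change (fun a : A => a ^+ q) F.

(** Apply to the relation the linear map into [coinduced M] through which
    [fun a => kappa_s a *: m] factors, and evaluate at 1. *)
Lemma unit_relation (s : I) (J : finType) (a : J -> A) (y : J -> M) :
  \sum_j a j *: F (y j) = 0 -> \sum_j kappa s (a j) *: y j = 0.
Proof.
move=> rel; have [_ univ] := uF.
have kP m : (fun x => kappa s x *: m) \in @additive_pred A M.
  by apply/asboolP => x z; rewrite kD scalerDl.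
have [|g [gE _]] := univ (coinduced M) (fun m => Coinduced (kP m)).
  split=> [m m'|a' m]; apply: val_inj; apply/funext => x /=.
    by rewrite scalerDr.
  by rewrite mulrC kM scalerA mulrC.
have := congr1 (fun h : coinduced M => h 1) (congr1 g rel).
rewrite linear0 linear_sum coinduced_sumE => e.
rewrite -[RHS]/((0 : coinduced M) 1) -e.
by apply: eq_bigr => j _; rewrite linearZ /= gE /= mul1r.
Qed.

Lemma unit_span (S : set M) : submodule S -> (forall y, S (F y)) -> forall x, S x.
Proof. exact: base_change_span uF S. Qed.
End Relation.

Definition twisted_comb (M : lmodType A) (F : M -> M) n (m : 'I_n -> M)
    (d : nat) (a : nat -> 'I_n -> A) : M :=
  \sum_j \sum_(i < d) a i j *: iter i F (m j).

Section Comb.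
Variables (M : lmodType A) (F : M -> M) (n : nat) (m : 'I_n -> M).
Hypothesis sF : semilinear_map (fun a : A => a ^+ q) F.
Notation comb := (twisted_comb F m).

Lemma twisted_combD d a b : comb d (fun i j => a i j + b i j) = comb d a + comb d b.
Proof.
rewrite -big_split; apply: eq_bigr => j _; rewrite -big_split.
by apply: eq_bigr => i _; rewrite scalerDl.
Qed.

Lemma twisted_combZ d c a : comb d (fun i j => c * a i j) = c *: comb d a.
Proof.
rewrite scaler_sumr; apply: eq_bigr => j _; rewrite scaler_sumr.
by apply: eq_bigr => i _; rewrite scalerA.
Qed.

Lemma twisted_comb_sum d (J : finType) (a : J -> nat -> 'I_n -> A) :
  comb d (fun i j => \sum_l a l i j) = \sum_l comb d (a l).
Proof.
rewrite exchange_big; apply: eq_bigr => j _.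
rewrite exchange_big; apply: eq_bigr => i _.
by rewrite scaler_suml.
Qed.

(** Coefficients beyond [d] are ignored by [twisted_comb]; replacing them by
    zero allows a combination to be read in any larger degree. *)
Definition truncate d (a : nat -> 'I_n -> A) i j := if (i < d)%N then a i j else 0.

Lemma twisted_comb_truncate d e a : (d <= e)%N -> comb e (truncate d a) = comb d a.
Proof.
move=> de; apply: eq_bigr => j _.
rewrite (big_ord_widen e (fun i => a i j *: iter i F (m j))) // [RHS]big_mkcond.
by apply: eq_bigr => i _; rewrite /truncate; case: ifP => // _; rewrite scale0r.
Qed.

Lemma twisted_comb_recl d a :
  comb d.+1 a = \sum_j a 0%N j *: m j +
    \sum_j \sum_(i < d) a i.+1 j *: F (iter i F (m j)).
Proof.
by rewrite -big_split; apply: eq_bigr => j _; rewrite big_ord_recl.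
Qed.

Lemma frob_twisted_comb d a :
  F (comb d a) = \sum_j \sum_(i < d) a i j ^+ q *: F (iter i F (m j)).
Proof.
have [FD _] := sF.
transitivity (\sum_j F (\sum_(i < d) a i j *: iter i F (m j))).
  have F0 := semilinear0 sF; rewrite /twisted_comb.
  by elim/big_rec2: _ => // j x y _ <-.
by apply: eq_bigr => j _; rewrite (semilinear_sum _ _ _ _ sF).
Qed.
End Comb.

Section Descent.
Variables (n d0 : nat) (c : 'I_n -> nat -> 'I_n -> A).

(** The coefficients obtained by replacing [m l] by
    [\sum_j \sum_(i < d0) c l i j *: F^(i+1) (m j)]: every term then contains
    [F], and the coefficient of [F^(i+1) (m j)] is [eliminate a i j]. *)
Definition eliminate (a : nat -> 'I_n -> A) : nat -> 'I_n -> A := fun i j =>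
  a i.+1 j + \sum_l a 0%N l * truncate d0 (c l) i j.

Lemma twisted_comb_eliminate (M : lmodType A) (F : M -> M) (m : 'I_n -> M) d a :
    (forall l, m l = \sum_j \sum_(i < d0) c l i j *: F (iter i F (m j))) ->
    (d0 <= d)%N ->
  twisted_comb F m d.+1 a = \sum_j \sum_(i < d) eliminate a i j *: F (iter i F (m j)).
Proof.
move=> mE le; rewrite twisted_comb_recl.
pose m' j := F (m j).
have iterE (G : nat -> 'I_n -> A) e : \sum_j \sum_(i < e) G i j *: F (iter i F (m j)) =
    twisted_comb F m' e G.
  by apply: eq_bigr => j _; apply: eq_bigr => i _; rewrite -iterS iterSr.
rewrite !iterE twisted_combD [LHS]addrC; congr (_ + _); first exact: iterE.
have /= -> := twisted_comb_sum F m' d (fun l i j => a 0%N l * truncate d0 (c l) i j).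
apply: eq_bigr => l _; rewrite twisted_combZ twisted_comb_truncate //.
by rewrite [in LHS]mE iterE.
Qed.

Variables (M : lmodType A) (F : M -> M) (m : 'I_n -> M) (N : lmodType A)
  (G : N -> N) (b : 'I_n -> N).
Hypotheses (uF : is_base_change (fun a : A => a ^+ q) F)
  (sG : semilinear_map (fun a : A => a ^+ q) G)
  (mE : forall l, m l = \sum_j \sum_(i < d0) c l i j *: F (iter i F (m j)))
  (low : forall a, twisted_comb F m d0.+1 a = 0 -> twisted_comb G b d0.+1 a = 0).

(** The expression of [m l] through the [F^(i+1) (m j)] is itself a relation
    of low degree. *)
Lemma low_root l : b l = \sum_j \sum_(i < d0) c l i j *: G (iter i G (b j)).
Proof.
pose a i j : A := if i is i'.+1 then - c l i' j else (j == l)%:R.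
have aE (P : lmodType A) (H : P -> P) (x : 'I_n -> P) : twisted_comb H x d0.+1 a =
    x l - \sum_j \sum_(i < d0) c l i j *: H (iter i H (x j)).
  rewrite twisted_comb_recl (bigD1 l) //= eqxx scale1r big1 ?addr0 => [|j /negPf->].
    rewrite -sumrN; congr (_ + _); apply: eq_bigr => j _; rewrite -sumrN.
    by apply: eq_bigr => i _; rewrite scaleNr.
  by rewrite scale0r.
by apply/eqP; rewrite -subr_eq0 -aE low // aE -mE subrr.
Qed.

(** Induction on the degree [d].  After elimination a relation has the form
    [\sum a_ij F (F^i m_j) = 0], and the coordinates [kappa_s a_ij] give relations
    of smaller degree, from which the one for the [b_j] is recovered through
    [a = \sum_s kappa_s a ^+ q * t_s]. *)
Lemma relation_descent d a : twisted_comb F m d a = 0 -> twisted_comb G b d a = 0.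
Proof.
wlog : d a / (d0 < d)%N => [th rel|].
  rewrite -(twisted_comb_truncate _ _ _ (leq_addr d0.+1 d)); apply: th.
    by rewrite addnS ltnS leq_addl.
  by rewrite twisted_comb_truncate ?leq_addr.
elim: d a => // d IH a; rewrite ltnS leq_eqVlt => /orP[/eqP<-|lt]; first exact: low.
rewrite (twisted_comb_eliminate _ mE (ltnW lt)).
rewrite (twisted_comb_eliminate _ low_root (ltnW lt)) => rel.
have rk s : twisted_comb G b d (fun i j => kappa s (eliminate a i j)) = 0.
  apply: IH lt _; rewrite /twisted_comb pair_big.
  have H : \sum_(p : 'I_n * 'I_d) eliminate a p.2 p.1 *: F (iter p.2 F (m p.1)) = 0.
    by rewrite -[RHS]rel [RHS]pair_big.
  exact: (unit_relation uF s (a := fun p : 'I_n * 'I_d => eliminate a p.2 p.1)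
    (y := fun p => iter p.2 F (m p.1))) H.
transitivity (\sum_s t s *: G (twisted_comb G b d (fun i j => kappa s (eliminate a i j)))).
  rewrite [RHS](eq_bigr (fun s => \sum_j \sum_(i < d)
    (kappa s (eliminate a i j) ^+ q * t s) *: G (iter i G (b j)))) => [|s _].
    rewrite [RHS]exchange_big; apply: eq_bigr => j _; rewrite [RHS]exchange_big.
    by apply: eq_bigr => i _; rewrite -scaler_suml -kE.
  rewrite (frob_twisted_comb _ sG) scaler_sumr; apply: eq_bigr => j _.
  rewrite scaler_sumr; apply: eq_bigr => i _.
  by rewrite scalerA mulrC.
by rewrite big1 // => s _; rewrite rk (semilinear0 sG) scaler0.
Qed.
End Descent.

Lemma submodule_relations n (N : lmodType A) (G : N -> N) (b : 'I_n -> N) d :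
  submodule [set a : 'M[A]_(d, n) | \sum_j \sum_i a i j *: iter i G (b j) = 0].
Proof.
split=> /=.
- by rewrite big1 // => j _; rewrite big1 // => i _; rewrite mxE scale0r.
- move=> x y hx hy; transitivity ((\sum_j \sum_i x i j *: iter i G (b j)) +
    \sum_j \sum_i y i j *: iter i G (b j)); last by rewrite hx hy addr0.
  rewrite -big_split; apply: eq_bigr => j _.
  by rewrite -big_split; apply: eq_bigr => i _; rewrite mxE scalerDl.
- move=> s x hx; transitivity (s *: \sum_j \sum_i x i j *: iter i G (b j)).
    rewrite scaler_sumr; apply: eq_bigr => j _.
    by rewrite scaler_sumr; apply: eq_bigr => i _; rewrite mxE scalerA.
  by rewrite hx scaler0.
Qed.

(** The bound [d0] is such that each generator is a combination of the
    [F^(i+1) (m j)] with [i < d0]; the relations of degree at most [d0] are a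
    submodule of a finite free module. *)
Lemma unit_finite_presentation (M : lmodType A) (F : M -> M) n (m : 'I_n -> M) :
    noetherian A -> is_base_change (fun a : A => a ^+ q) F ->
    (forall x, exists d a, x = twisted_comb F m d a) ->
  exists (d : nat) (l : seq 'M[A]_(d, n)),
    (forall a, a \in l -> \sum_j \sum_i a i j *: iter i F (m j) = 0) /\
    forall (N : lmodType A) (G : N -> N) (b : 'I_n -> N),
      semilinear_map (fun a : A => a ^+ q) G ->
      (forall a, a \in l -> \sum_j \sum_i a i j *: iter i G (b j) = 0) ->
    forall d' a, twisted_comb F m d' a = 0 -> twisted_comb G b d' a = 0.
Proof.
move=> nA uF gen; have [sF _] := uF.
pose T d (a : nat -> 'I_n -> A) := \sum_j \sum_(i < d) a i j *: F (iter i F (m j)).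
have TE d a : T d a = twisted_comb F (F \o m) d a.
  by apply: eq_bigr => j _; apply: eq_bigr => i _; rewrite -iterS iterSr.
have Tspan x : exists d a, x = T d a.
  apply: (unit_span uF (S := [set x | exists d a, x = T d a])).
    split.
    - exists 0%N, (fun _ _ => 0); rewrite /T big1 // => j _; by rewrite big_ord0.
    - move=> _ _ [d [a ->]] [e [b ->]].
      exists (maxn d e), (fun i j => truncate d a i j + truncate e b i j).
      by rewrite !TE twisted_combD !twisted_comb_truncate ?leq_maxl ?leq_maxr.
    - move=> s _ [d [a ->]]; exists d, (fun i j => s * a i j).
      by rewrite !TE twisted_combZ.
  move=> y; have [d [a ->]] := gen y.
  by exists d, (fun i j => a i j ^+ q); rewrite (frob_twisted_comb _ sF).
have /choice[dl hdl] : forall l, exists d, exists a, m l = T d a by [].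
have /choice[al hal] := hdl.
pose d0 := \max_l dl l.
pose c l := truncate (dl l) (al l).
have mE l : m l = \sum_j \sum_(i < d0) c l i j *: F (iter i F (m j)).
  rewrite -[RHS]/(T d0 (c l)) TE twisted_comb_truncate -?TE //.
  exact: (leq_bigmax l).
pose R : set 'M[A]_(d0.+1, n) := [set a : 'M[A]_(d0.+1, n) | \sum_j \sum_i a i j *: iter i F (m j) = 0].
have [||l [l1 l2]] := @noetherian_fin_gen A 'M[A]_(d0.+1, n)
  [seq delta_mx p.1 p.2 | p : 'I_d0.+1 * 'I_n] R nA.
- exact: submodule_relations.
- move=> a _ S hS hl; rewrite (matrix_sum_delta a).
  apply: submodule_sum => // i _; apply: submodule_sum => // j _.
  case: (hS) => _ _; apply; apply: hl.
  by apply/mapP; exists (i, j); rewrite ?mem_enum.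
exists d0.+1, l; split=> // N G b sG hl.
apply: relation_descent uF sG mE _ => a rel.
have toM (P : lmodType A) (H : P -> P) (x : 'I_n -> P) : twisted_comb H x d0.+1 a =
   \sum_j \sum_(i < d0.+1) (\matrix_(i, j) a i j : 'M_(d0.+1, n)) i j *: iter i H (x j).
  by apply: eq_bigr => j _; apply: eq_bigr => i _; rewrite mxE.
rewrite toM in rel; rewrite toM.
have hR : R (\matrix_(i, j) a i j) by exact: rel.
exact: (l2 _ hR _ (submodule_relations G b d0.+1) hl).
Qed.

(** The finite list [l] of relations does not depend on the target, so it can
    be checked on germs before a neighbourhood is chosen. *)
Lemma unit_hom_exists (M : lmodType A) (F : M -> M) n (m : 'I_n -> M) :
    noetherian A -> is_base_change (fun a : A => a ^+ q) F ->
    (forall x, exists d a, x = twisted_comb F m d a) ->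
  exists (d : nat) (l : seq 'M[A]_(d, n)),
    (forall a, a \in l -> \sum_j \sum_i a i j *: iter i F (m j) = 0) /\
    forall (N : lmodType A) (G : N -> N) (b : 'I_n -> N),
      semilinear_map (fun a : A => a ^+ q) G ->
      (forall a, a \in l -> \sum_j \sum_i a i j *: iter i G (b j) = 0) ->
    exists g : {linear M -> N}, (forall x, g (F x) = G (g x)) /\ forall j, g (m j) = b j.
Proof.
move=> nA uF gen; have [d [l [lM lN]]] := unit_finite_presentation nA uF gen.
exists d, l; split=> // N G b sG hl; have [sF _] := uF.
have /choice[rep hrep] : forall x, exists da, x = twisted_comb F m da.1 da.2.
  by move=> x; have [e [a xE]] := gen x; exists (e, a).
pose f x := twisted_comb G b (rep x).1 (rep x).2.
have fE e a : f (twisted_comb F m e a) = twisted_comb G b e a.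
  set x := twisted_comb F m e a; pose e' := maxn e (rep x).1.
  pose a' i j := truncate e a i j + (-1) * truncate (rep x).1 (rep x).2 i j.
  have cE (P : lmodType A) (H : P -> P) (y : 'I_n -> P) : twisted_comb H y e' a' =
      twisted_comb H y e a - twisted_comb H y (rep x).1 (rep x).2.
    rewrite twisted_combD (twisted_combZ _ _ _ (-1)) !twisted_comb_truncate ?leq_maxl ?leq_maxr //.
    by rewrite scaleN1r.
  have := lN N G b sG hl e' a'; rewrite !cE -hrep subrr => /(_ erefl)/eqP.
  by rewrite subr_eq0 => /eqP->.
have [||g gE] := @linear_exists A M N f.
- move=> x y; rewrite {1}(hrep x) {1}(hrep y); set u := rep x; set v := rep y.
  rewrite -(twisted_comb_truncate _ _ _ (leq_maxl u.1 v.1)).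
  rewrite -(twisted_comb_truncate _ _ v.2 (leq_maxr u.1 v.1)) -twisted_combD fE.
  by rewrite twisted_combD !twisted_comb_truncate ?leq_maxl ?leq_maxr.
- by move=> a x; rewrite {1}(hrep x) -twisted_combZ fE twisted_combZ.
exists g; split=> [x|j]; rewrite !gE.
  rewrite {1}(hrep x) (frob_twisted_comb _ sF).
  pose a i j : A := if i is i'.+1 then (rep x).2 i' j ^+ q else 0.
  have shift (P : lmodType A) (H : P -> P) (y : 'I_n -> P) :
      \sum_j \sum_(i < (rep x).1) (rep x).2 i j ^+ q *: H (iter i H (y j)) =
      twisted_comb H y (rep x).1.+1 a.
    by rewrite twisted_comb_recl [X in X + _]big1 ?add0r // => j _; rewrite scale0r.
  by rewrite shift fE -shift -(frob_twisted_comb _ sG).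
pose a (i : nat) l : A := (l == j)%:R.
have aE (P : lmodType A) (H : P -> P) (y : 'I_n -> P) : twisted_comb H y 1 a = y j.
  rewrite /twisted_comb (bigD1 j) //= big_ord1 /a eqxx scale1r big1 ?addr0 // => l0 /negPf h.
  by rewrite big_ord1 h scale0r.
by rewrite -[in LHS](aE M F m) fE aE.
Qed.

End UnitModule.

(** * Units and basic open subsets of affine opens *)

Lemma opens_ext (T : topologicalType) (U V : opens T) : oset U = oset V -> U = V.
Proof. by case: U V => [U oU] [V oV] /= e; subst V; rewrite (Prop_irrelevance oU oV). Qed.

Section UnitAt.
Variable X : ringedSpace.
Implicit Types U V W : opens X.

Lemma res_irr U V (h h' : V `<=` U) (s : sec U) : res h s = res h' s.
Proof. by rewrite (Prop_irrelevance h h'). Qed.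

Lemma opensI_open U V : open (oset U `&` oset V).
Proof. by apply: openI; exact: oset_open. Qed.
Definition opensI U V : opens X := Opens (opensI_open U V).

Lemma subIl U V : opensI U V `<=` U. Proof. by move=> x []. Qed.
Lemma subIr U V : opensI U V `<=` V. Proof. by move=> x []. Qed.

Lemma unit_at_res U V (h : V `<=` U) (s : sec U) x :
  oset V x -> unit_at (res h s) x <-> unit_at s x.
Proof.
move=> Vx; split=> [[W [hW [Wx [t ht]]]]|[W [hW [Wx [t ht]]]]].
  exists W, (subset_trans hW h); split=> //; exists t.
  by rewrite -(res_comp h hW).
exists (opensI V W), (@subIl V W); split=> //.
exists (res (@subIr V W) t).
rewrite (res_comp h (@subIl V W) (subset_trans (@subIl V W) h)).
by rewrite -(res_comp hW (@subIr V W)) -rmorphM ht rmorph1.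
Qed.

Lemma unit_atM U (s t : sec U) x : unit_at (s * t) x <-> unit_at s x /\ unit_at t x.
Proof.
split=> [[V [h [Vx [u hu]]]]|[[V [h [Vx [u hu]]]] [W [k [Wx [v hv]]]]]].
  rewrite rmorphM in hu.
  by split; exists V, h; split=> //; [exists (res h t * u); rewrite mulrA|
    exists (res h s * u); rewrite mulrA [_ * res h s]mulrC].
exists (opensI V W), (subset_trans (@subIl V W) h); split=> //.
exists (res (@subIl V W) u * res (@subIr V W) v).
rewrite rmorphM mulrACA -(res_comp h (@subIl V W)) -rmorphM hu rmorph1 mul1r.
by rewrite (res_irr _ (subset_trans (@subIr V W) k)) -(res_comp k (@subIr V W)) -rmorphM hv rmorph1.
Qed.

Lemma unit_atX U (s : sec U) n x : unit_at s x -> unit_at (s ^+ n) x.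
Proof.
move=> [V [h [Vx [u hu]]]]; exists V, h; split=> //; exists (u ^+ n).
by rewrite rmorphXn -exprMn hu expr1n.
Qed.

Lemma unit_at1 U x : oset U x -> unit_at (1 : sec U) x.
Proof.
move=> Ux; exists U, (@subset_refl _ _); split=> //; exists 1.
by rewrite rmorph1 mulr1.
Qed.

Lemma unit_at_in U (s : sec U) x : unit_at s x -> oset U x.
Proof. by move=> [V [h [Vx _]]]; exact: h. Qed.

Lemma unit_at_inv U (s t : sec U) x : oset U x -> s * t = 1 -> unit_at s x.
Proof.
by move=> Ux st; have := unit_at1 Ux; rewrite -st => /unit_atM[].
Qed.

Lemma basic_open_open U (s : sec U) : open [set x | unit_at s x].
Proof.
rewrite (_ : [set x | _] = \bigcup_(V in [set V : opens X |
    exists h : V `<=` U, exists t, res h s * t = 1]) oset V).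
  by apply: bigcup_open => V _; exact: oset_open.
apply/seteqP; split=> [x [V [h [Vx [t ht]]]]|x [V [h [t ht]] Vx]].
  by exists V => //; exists h, t.
by exists V, h; split=> //; exists t.
Qed.
Definition basic_open U (s : sec U) : opens X := Opens (basic_open_open s).

Lemma basic_open_sub U (s : sec U) : basic_open s `<=` U.
Proof. by move=> x; exact: unit_at_in. Qed.

End UnitAt.

Section AffineOpen.
Variable X : ringedSpace.
Hypothesis locX : locally_ringed X.
Implicit Types U V W : opens X.

(** These are the sections whose germ lies in the maximal ideal at [x]. *)
Lemma nonunit_prime U x : oset U x -> prime_ideal [set s : sec U | ~ unit_at s x].
Proof.
move=> Ux; split=> /=.
- move=> [V [h [Vx [t ht]]]]; have [h0 _] := locX x; apply: h0.
  exists V, (@subsetT _ V); split=> //; exists t.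
  by rewrite rmorph0 -(rmorph0 (res h)).
- move=> a b na nb [V [h [Vx [c hc]]]]; have [_ h1] := locX x.
  have [] := h1 V (res h a * c) Vx; first by move=> /unit_atM[/(unit_at_res h a Vx)].
  rewrite -hc rmorphD mulrDl addrAC subrr add0r.
  by move=> /unit_atM[/(unit_at_res h b Vx)].
- by move=> a b nb /unit_atM[].
- by apply; exact: unit_at1.
- move=> a b nab; case: (pselect (unit_at a x)) => ha; last by left.
  by right=> hb; apply: nab; apply/unit_atM.
Qed.

(** [V] is the locus where [s] is invertible, and its ring of sections is the
    localization of [sec U] at [s].  Primes of the localization are primes of
    [sec U] avoiding [s], and localizing it at [t] amounts to localizing [sec U]
    at [s * a], where [a] is a numerator of [t]. *)
Lemma basic_open_affine U (s : sec U) (V : opens X) : affine_open U ->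
  (forall y, oset V y <-> unit_at s y) -> affine_open V.
Proof.
move=> [pU ptU basU locU] VE.
have h : V `<=` U by move=> y /VE; exact: unit_at_in.
have VE' y : oset V y <-> oset U y /\ unit_at s y.
  by split=> [Vy|[_ /VE]//]; split; [exact: (h _ Vy)|apply/VE].
have [[c sc] surj inj] := locU s V h VE'.
split.
- by move=> y Vy; exact: nonunit_prime.
- move=> P [P0 PD PM P1 Pp].
  have pP : prime_ideal (res h @^-1` P).
    split=> /=; first by rewrite rmorph0.
    + by move=> a b; rewrite rmorphD; exact: PD.
    + by move=> a b; rewrite rmorphM; exact: PM.
    + by rewrite rmorph1.
    + by move=> a b; rewrite rmorphM; exact: Pp.
  have [y [[Uy yE] y_uniq]] := ptU _ pP.
  have PX (t : sec V) n : P (res h s ^+ n * t) -> P t.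
    move=> Pt; have := PM (c ^+ n) _ Pt.
    by rewrite mulrA -exprMn [c * _]mulrC sc expr1n mul1r.
  have sy : unit_at s y.
    apply: contrapT => ns; apply: P1; have : (res h @^-1` P) s by rewrite yE.
    by move=> Ps; rewrite -sc mulrC; exact: PM.
  exists y; split; last first.
    move=> z [Vz zE]; apply: y_uniq; split; first exact: (h _ Vz).
    apply/seteqP; split=> a /=; first by rewrite zE /= unit_at_res.
    by rewrite zE /= unit_at_res.
  split; first exact/VE.
  have Vy : oset V y by apply/VE.
  apply/seteqP; split=> t /=.
    move=> Pt ut; have [n [a e]] := surj t.
    have Pa : (res h @^-1` P) a by rewrite /= -e; exact: PM.
    move: Pa; rewrite yE /=; apply.
    rewrite -(unit_at_res h a Vy) -e; apply/unit_atM; split=> //.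
    by apply: unit_atX; apply: unit_at_inv sc.
  move=> nt; have [n [a e]] := surj t; apply: (PX t n); rewrite e.
  suff : (res h @^-1` P) a by [].
  rewrite yE /= => /(unit_at_res h a Vy); rewrite -e => /unit_atM[] //.
- move=> W y Vy Wy; have [a [ua aW]] := basU W y (h _ Vy) Wy.
  exists (res h a); split; first exact/unit_at_res.
  move=> z Vz /(unit_at_res h a Vz); apply: aW; exact: (h _ Vz).
- move=> t W k WE; have [n [a e]] := surj t.
  have hW : W `<=` U := subset_trans k h.
  have [] := locU (s * a) W hW.
    move=> y; split=> [Wy|[Uy /unit_atM[us ua]]].
      have [Vy ut] := (WE y).1 Wy; split; first exact: hW.
      apply/unit_atM; split; first exact/VE.
      rewrite -(unit_at_res h a Vy) -e; apply/unit_atM; split=> //.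
      by apply: unit_atX; apply: unit_at_inv sc.
    have Vy : oset V y by apply/VE.
    apply/WE; split=> //.
    by move: ua; rewrite -(unit_at_res h a Vy) -e => /unit_atM[].
  have rk b : res hW b = res k (res h b) by rewrite (res_comp h k hW).
  have tE m : c ^+ (n.+1 * m) * res h (s * a) ^+ m = t ^+ m.
    rewrite rmorphM -e mulrA -exprS exprMn -exprM mulrA -exprMn [c * _]mulrC.
    by rewrite sc expr1n mul1r.
  move=> [b sab] surjW injW; split.
  + exists (res k (res h s) ^+ n.+1 * b).
    rewrite -[RHS]sab rk (rmorphM (res h)) -e !rmorphM !rmorphXn exprS mulrA.
    by congr (_ * b); rewrite mulrC -mulrA.
  + move=> w; have [m [a' e']] := surjW w.
    exists m, (c ^+ (n.+1 * m) * res h a').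
    by rewrite rmorphM -rk -e' rk mulrA -!(rmorphXn (res k)) -(rmorphM (res k)) tE.
  + move=> t' kt'; have [j [a' e']] := surj t'.
    have [|m em] := injW a'; first by rewrite rk -e' rmorphM kt' mulr0.
    have t'E : t' = c ^+ j * res h a'.
      by rewrite -e' mulrA -exprMn [c * _]mulrC sc expr1n mul1r.
    exists m; rewrite -tE t'E mulrACA -(rmorphXn (res h)) -(rmorphM (res h)) em.
    by rewrite rmorph0 mulr0.
Qed.

End AffineOpen.

Lemma affine_basis (X : scheme) (x : X) (V : opens X) : oset V x ->
  exists U : opens X, [/\ oset U x, affine_open U & U `<=` V].
Proof.
move=> Vx; have [U [Ux aU]] := scheme_affine x.
have [_ _ bas _] := aU; have [s [us sV]] := bas V x Ux Vx.
exists (basic_open s); split=> //.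
  by apply: (basic_open_affine (@scheme_local X) aU (s := s)).
by move=> y uy; apply: sV => //; exact: unit_at_in uy.
Qed.

(** * Open subschemes *)

Section OpenSubspace.
Variables (X : ringedSpace) (U : opens X).

Definition sub_point : Type := {x : X | `[< oset U x >]}.
HB.instance Definition _ := Choice.on sub_point.
Definition sub_val (y : sub_point) : X := val y.
Definition sub_space : topologicalType := initial_topology sub_val.
Definition sub_incl (y : sub_space) : X := val (y : sub_point).

Lemma sub_inclP (y : sub_space) : oset U (sub_incl y).
Proof. exact/asboolP/(valP (y : sub_point)). Qed.

Lemma sub_incl_inj : injective sub_incl.
Proof. by move=> x y /val_inj. Qed.

Lemma sub_incl_onto x : oset U x -> exists y, sub_incl y = x.
Proof. by move=> /asboolP Ux; exists (exist _ x Ux). Qed.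

Lemma sub_incl_cont : continuous sub_incl.
Proof. exact: initial_continuous. Qed.

Lemma sub_image_open (V : opens sub_space) : open (sub_incl @` V).
Proof.
have [A oA AV] := oset_open V.
rewrite (_ : _ @` _ = A `&` U); first by apply: openI => //; exact: oset_open.
apply/seteqP; split=> [_ [y Vy <-]|x [Ax /sub_incl_onto[y yx]]].
  by split; [by move: Vy; rewrite -AV|exact: sub_inclP].
by exists y => //; rewrite -AV; move: Ax; rewrite -yx.
Qed.
Definition sub_image (V : opens sub_space) : opens X := Opens (@sub_image_open V).

Lemma sub_preimage_open (V : opens X) : open (sub_incl @^-1` V).
Proof. by apply: (continuousP _).1; [exact: sub_incl_cont|exact: oset_open]. Qed.
Definition sub_preimage (V : opens X) : opens sub_space := Opens (sub_preimage_open V).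

Lemma sub_image_mono (V W : opens sub_space) : W `<=` V -> sub_image W `<=` sub_image V.
Proof. by move=> h _ [y Wy <-]; exists y => //; exact: h. Qed.

Lemma sub_image_sub (V : opens sub_space) : sub_image V `<=` U.
Proof. by move=> _ [y _ <-]; exact: sub_inclP. Qed.

Lemma sub_image_preimage (V : opens X) : V `<=` U -> sub_image (sub_preimage V) = V.
Proof.
move=> VU; apply: opens_ext; apply/seteqP; split=> [_ [y Vy <-]//|x Vx].
by have [y yx] := sub_incl_onto (VU _ Vx); exists y; rewrite /= ?yx.
Qed.

Lemma sub_image_mem (V : opens sub_space) y : oset (sub_image V) (sub_incl y) <-> oset V y.
Proof.
by split=> [[z Vz /sub_incl_inj<-//]|Vy]; exists y.
Qed.

Lemma sub_imageT : sub_image (openW sub_space) = U.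
Proof.
apply: opens_ext; apply/seteqP; split=> [|x /sub_incl_onto[y <-]]; first exact: sub_image_sub.
by exists y.
Qed.

Definition open_ringed_space : ringedSpace.
Proof.
refine (@RingedSpace sub_space (fun V => sec (sub_image V))
  (fun V W h => @res X _ _ (sub_image_mono h)) _ _ _ _).
- by move=> V h s; exact: res_id.
- by move=> V W W' h1 h2 h3 s; exact: res_comp.
- move=> I V W h cov s t st.
  apply: (@sec_separated X I (sub_image V) (fun i => sub_image (W i)) (fun i => sub_image_mono (h i))) => //.
  by move=> _ [y /cov[i _ Wy] <-]; exists i => //; exists y.
- move=> I V W h cov s st.
  apply: (@sec_glue X I (sub_image V) (fun i => sub_image (W i)) (fun i => sub_image_mono (h i))).
    by move=> _ [y /cov[i _ Wy] <-]; exists i => //; exists y.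
  move=> i j O hi hj.
  have OU : O `<=` U := subset_trans hi (@sub_image_sub _).
  have kO : O `<=` sub_image (sub_preimage O) by rewrite sub_image_preimage.
  have ki : sub_preimage O `<=` W i by move=> y /hi /sub_image_mem.
  have kj : sub_preimage O `<=` W j by move=> y /hj /sub_image_mem.
  by rewrite -(res_comp (sub_image_mono ki) kO) -(res_comp (sub_image_mono kj) kO) (st i j _ ki kj).
Defined.

Lemma sub_unit_at (V : opens open_ringed_space) (s : sec V) (y : sub_space) :
  @unit_at open_ringed_space V s y <-> @unit_at X (sub_image V) s (sub_incl y).
Proof.
split=> [[W [h [Wy [t ht]]]]|[W [h [Wy [t ht]]]]].
  exists (sub_image W), (sub_image_mono h); split; first by exists y.
  by exists t.
have WU : W `<=` U := subset_trans h (@sub_image_sub _).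
have k : sub_image (sub_preimage W) `<=` W by rewrite sub_image_preimage.
have kV : sub_preimage W `<=` V by move=> z /h /sub_image_mem.
exists (sub_preimage W), kV; split=> //; exists (res k t).
rewrite -[RHS](rmorph1 (res k)) -ht rmorphM; congr (_ * _).
by rewrite /= (res_comp h k (sub_image_mono kV)).
Qed.

Lemma sub_affine_open (V : opens open_ringed_space) :
  affine_open (sub_image V) -> affine_open V.
Proof.
move=> [pV ptV basV locV].
have setE (y : open_ringed_space) : [set s : sec V | ~ unit_at s y] =
    [set s : sec (sub_image V) | ~ unit_at s (sub_incl y)].
  by apply/seteqP; split=> s /= ns us; apply: ns; apply/sub_unit_at.
split.
- by move=> y Vy; rewrite setE; apply: pV; exists y.
- move=> P /ptV[x [[Vx ->] x_uniq]]; have [y Vy yx] := Vx.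
  exists y; split=> [|z [Vz Pz]].
    by split=> //; rewrite setE yx.
  apply: sub_incl_inj; rewrite yx; apply: x_uniq; split; first by exists z.
  by rewrite Pz setE.
- move=> W y Vy Wy; have [||s [us sW]] := basV (sub_image W) (sub_incl y); try by exists y.
  exists s; split; first exact/sub_unit_at.
  by move=> z Vz /sub_unit_at us'; apply/sub_image_mem/sW => //; exists z.
- move=> s W h WE; apply: locV => x; split=> [[y Wy <-]|[[y Vy <-] us]].
    have [Vy us] := (WE y).1 Wy; split; first by exists y.
    exact/sub_unit_at.
  by exists y => //; apply/WE; split=> //; exact/sub_unit_at.
Qed.

Lemma sub_image_le (V : opens X) (W : opens sub_space) :
  W `<=` sub_incl @^-1` V -> sub_image W `<=` V.
Proof. by move=> h _ [y Wy <-]; exact: h. Qed.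

Definition open_mor : mor open_ringed_space X.
Proof.
refine (@Mor open_ringed_space X sub_incl sub_incl_cont
  (fun V W h => @res X V (sub_image W) (sub_image_le h)) _ _).
- move=> V V' W W' h h' hV hW s /=.
  have k : sub_image W' `<=` V by apply: subset_trans (sub_image_le h') hV.
  by rewrite !(res_comp _ _ k).
- move=> V W h s y Wy /sub_unit_at; rewrite unit_at_res //.
  by exists y.
Defined.

Lemma open_morE (V : opens X) (W : opens open_ringed_space) (h : W `<=` open_mor @^-1` V)
  (k : sub_image W `<=` V) (s : sec V) : pull open_mor h s = res k s.
Proof. by rewrite /= (res_irr _ k). Qed.

End OpenSubspace.

Section OpenSubscheme.
Variables (X : scheme) (U : opens X).

Lemma open_local : locally_ringed (open_ringed_space U).
Proof.
move=> y; have [h0 h1] := @scheme_local X (sub_incl y); split.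
  move=> /sub_unit_at [V [h [Vy [t ht]]]]; apply: h0.
  exists V, (@subsetT _ V); split=> //; exists t.
  by rewrite -ht !rmorph0.
move=> V s Vy; have [|u|u] := h1 (sub_image V) s; first by exists y.
  by left; apply/sub_unit_at.
by right; apply/sub_unit_at.
Qed.

Lemma open_affine (y : open_ringed_space U) :
  exists V : opens (open_ringed_space U), oset V y /\ affine_open V.
Proof.
have [V [Vy aV VU]] := affine_basis (sub_inclP y).
exists (sub_preimage U V); split=> //; apply: sub_affine_open.
by rewrite sub_image_preimage.
Qed.

Definition open_subscheme : scheme := Scheme open_local open_affine.

Lemma open_subscheme_affine : affine_open U -> affine_scheme open_subscheme.
Proof.
move=> aU; apply: sub_affine_open.
by rewrite -(sub_imageT U) in aU.
Qed.

Definition open_incl : mor open_subscheme X := open_mor U.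

Lemma open_immersion_incl : open_immersion open_incl.
Proof.
split.
- exact: sub_incl_inj.
- move=> V; exact: sub_image_open.
- move=> V W h e.
  have k : sub_image V `<=` W by rewrite /= e.
  have k' : W `<=` sub_image V by rewrite /= e.
  by exists (res k') => s; rewrite (open_morE _ k) (res_comp _ _ (@subset_refl _ _)) res_id.
Qed.

End OpenSubscheme.

(** * Étale morphisms on open subschemes *)

Section Localization.
Variables (B C : comPzRingType) (s : B) (psi : {rmorphism B -> C}).
Hypothesis loc : is_localization s psi.

Lemma localization_ext (E : comPzRingType) (f g : {rmorphism C -> E}) :
  (forall b, f (psi b) = g (psi b)) -> f =1 g.
Proof.
have [[c sc] surj _] := loc; move=> fg x; have [n [b e]] := surj x.
have key (h : {rmorphism C -> E}) : h x = h c ^+ n * h (psi b).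
  rewrite -e -rmorphXn -rmorphM; congr (h _).
  by rewrite mulrA -exprMn [c * _]mulrC sc expr1n mul1r.
rewrite !key fg; congr (_ ^+ _ * _).
by rewrite -[LHS]mulr1 -(rmorph1 g) -sc rmorphM -fg mulrA -rmorphM [c * _]mulrC sc rmorph1 mul1r.
Qed.

(** Send a fraction with numerator [b] and denominator [s ^+ n] to
    [f b * u ^+ n]; independence of the choice of fraction is [wd]. *)
Lemma localization_lift (E : comPzRingType) (f : {rmorphism B -> E}) u :
  f s * u = 1 -> exists g : {rmorphism C -> E}, forall b, g (psi b) = f b.
Proof.
have [[c sc] surj inj] := loc; move=> fu.
have unitX n : f s ^+ n * u ^+ n = 1 by rewrite -exprMn fu expr1n.
have wd x y n m b b' : x = y -> psi s ^+ n * x = psi b -> psi s ^+ m * y = psi b' ->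
    f b * u ^+ n = f b' * u ^+ m.
  move=> <- e e'; have [j ej] : exists j, s ^+ j * (s ^+ m * b - s ^+ n * b') = 0.
    apply: inj; rewrite rmorphB !rmorphM !rmorphXn -e -e' mulrCA subrr.
    by [].
  have {ej} : f s ^+ m * f b = f s ^+ n * f b'.
    apply/eqP; rewrite -subr_eq0 -!rmorphXn -!rmorphM -rmorphB -[f _]mul1r -(unitX j).
    by rewrite mulrAC -rmorphXn -rmorphM ej rmorph0 mul0r.
  move=> h; transitivity (f s ^+ m * f b * u ^+ n * u ^+ m).
    by rewrite [f s ^+ m * f b]mulrC -!mulrA [f s ^+ m * _]mulrCA unitX mulr1.
  by rewrite h [f s ^+ n * _ * _]mulrAC unitX mul1r.
have /choice[F hF] : forall x, exists y, forall n b, psi s ^+ n * x = psi b -> y = f b * u ^+ n.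
  move=> x; have [n [b e]] := surj x; exists (f b * u ^+ n) => m b' e'.
  exact: (wd x x).
have [||| g gE] := @rmorphism_exists C E F.
- move=> x y; have [n [b e]] := surj x; have [m [b' e']] := surj y.
  rewrite (hF x n b e) (hF y m b' e') (hF (x + y) (n + m)%N (s ^+ m * b + s ^+ n * b')).
    rewrite rmorphD !rmorphM !rmorphXn mulrDl exprD; congr (_ + _).
      by rewrite [u ^+ n * _]mulrC mulrACA unitX mul1r.
    by rewrite mulrACA unitX mul1r.
  rewrite rmorphD !rmorphM !rmorphXn -e -e' mulrDr exprD; congr (_ + _).
    by rewrite mulrA [_ ^+ m * _]mulrC.
  by rewrite mulrA.
- move=> x y; have [n [b e]] := surj x; have [m [b' e']] := surj y.
  rewrite (hF x n b e) (hF y m b' e') (hF (x * y) (n + m)%N (b * b')).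
    by rewrite rmorphM exprD mulrACA.
  by rewrite rmorphM -e -e' exprD mulrACA.
- by rewrite (hF 1 0%N 1) ?rmorph1 ?expr0 ?mulr1.
exists g => b; rewrite gE (hF _ 0%N b) ?expr0 ?mulr1 ?mul1r //.
Qed.

(** A lift to the localization exists as soon as [s] becomes invertible in
    [E].  It is invertible modulo the square-zero kernel, and an inverse up to
    [1 + e] is corrected by the factor [1 - e]. *)
Lemma etale_localization (A : comPzRingType) (phi : {rmorphism A -> B}) :
  etale_ring phi -> etale_ring (psi \o phi).
Proof.
have [[c sc] surj inj] := loc; case=> [[n [b hb]] fe]; split.
  exists n.+1, (fun i => oapp (psi \o b) c (unlift ord0 i)) => S SA Sb SD SM x.
  have Spsi y : S (psi y).
    apply: (hb (S \o psi)) => /= [a|i|y' y1|y' y1]; rewrite ?rmorphD ?rmorphM.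
    - exact: SA.
    - by have := Sb (lift ord0 i); rewrite liftK.
    - exact: SD.
    - exact: SM.
  have Sc : S c by have := Sb ord0; rewrite unlift_none.
  have [m [y e]] := surj x.
  have -> : x = c ^+ m * psi y.
    by rewrite -e mulrA -exprMn [c * _]mulrC sc expr1n mul1r.
  apply: (SM) => //; elim: m {e} => [|m IH]; last by rewrite exprS; apply: SM.
  by rewrite expr0 -(rmorph1 psi).
move=> E D pi surjpi sq f g fg.
have [h0 [h0f h0g h0u]] := fe E D pi surjpi sq f (g \o psi) fg.
have [c' c'E] := surjpi (g c).
pose e := h0 s * c' - 1.
have pe : pi e = 0 by rewrite rmorphB rmorphM h0g c'E rmorph1 /= -rmorphM sc rmorph1 subrr.
have [|h hE] := localization_lift (f := h0) (u := c' * (1 - e)).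
  rewrite mulrA -[h0 s * c'](subrK 1) -/e mulrDl mul1r mulrBr mulr1 (sq e e) //.
  by rewrite subr0 addrC subrK.
exists h; split.
- by move=> a /=; rewrite hE.
- move=> x; have h1 : (pi \o h : {rmorphism C -> D}) =1 g.
    by apply: localization_ext => y /=; rewrite hE h0g.
  exact: h1.
- move=> h' h'f h'g; apply: localization_ext => y.
  rewrite hE; apply: (h0u (h' \o psi)) => //= z; exact: h'g.
Qed.
End Localization.

Section EtaleOpen.
Variables (X Y : scheme).

(** Shrink the chart of the source to a basic open subset inside [U], which
    replaces its ring by a localization. *)
Lemma etale_open (f : mor X Y) (U : opens X) :
  etale f -> etale (mor_comp f (open_incl U)).
Proof.
move=> et y; have [V [W [h [Vy aV aW eV]]]] := et (sub_incl y).
have [_ _ bas loc] := aV.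
have [s [us sU]] := bas U _ Vy (sub_inclP y).
pose D := basic_open s.
have DV : D `<=` V := @basic_open_sub _ _ s.
have DU : D `<=` U by move=> z uz; apply: sU => //; exact: DV.
have iD : sub_image (sub_preimage U D) = D by exact: sub_image_preimage.
have k : oset (sub_preimage U D) `<=` mor_comp f (open_incl U) @^-1` W.
  by move=> z Dz; exact: (h _ (DV _ Dz)).
exists (sub_preimage U D), W, k; split=> //.
  apply: sub_affine_open; rewrite iD.
  by apply: (basic_open_affine (@scheme_local X) aV (s := s)).
have DV' : sub_image (sub_preimage U D) `<=` V by rewrite iD.
have loc' : is_localization s (res DV').
  apply: loc => z; rewrite iD; split=> [uz|[]//]; split=> //; exact: DV.
suff -> : pull (mor_comp f (open_incl U)) k = (res DV' \o pull f h : {rmorphism _ -> _}).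
  exact: etale_localization loc' _ _ eV.
apply: rmorphism_ext => a /=.
have P : oset (opre f W) `<=` f @^-1` W by [].
have k2 : sub_image (sub_preimage U D) `<=` opre f W by rewrite iD => z /DV /h.
rewrite (open_morE _ k2) (pull_res _ (subset_trans DV' h) (@subset_refl _ W) k2) res_id.
by rewrite (pull_res _ (subset_trans DV' h) (@subset_refl _ W) DV') res_id.
Qed.

End EtaleOpen.

Lemma pull_irr (X Y : ringedSpace) (f : mor X Y) (V : opens Y) (U : opens X)
  (h h' : U `<=` f @^-1` V) s : pull f h s = pull f h' s.
Proof. by rewrite (Prop_irrelevance h h'). Qed.

Lemma pull_restrict (X Y : ringedSpace) (f : mor X Y) (V : opens Y) (U U' : opens X)
  (h : U `<=` f @^-1` V) (h' : U' `<=` f @^-1` V) (k : U' `<=` U) s :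
  res k (pull f h s) = pull f h' s.
Proof. by rewrite (pull_res h h' (@subset_refl _ V) k) res_id. Qed.

Lemma mor_comp1f (X Y : ringedSpace) (f : mor X Y) : mor_comp (mor_id Y) f = f.
Proof.
apply: mor_ext => [//|V U h h' s] /=.
rewrite -(pull_res h' _ _ (@subset_refl _ U)) res_id; exact: pull_irr.
Qed.

Lemma gpull_comp (X Y Z : ringedSpace) (f : mor Y Z) (g : mor X Y) s :
  gpull (mor_comp f g) s = gpull g (gpull f s).
Proof.
have k : opre f (openW Z) `<=` openW Y by [].
rewrite /gpull /= -(pull_restrict (fun _ _ => I : oset (openW Z) _) _ k).
rewrite -(pull_res (fun _ _ => I : oset (openW Y) _) _ k (@subset_refl _ (openW X))).
by rewrite res_id.
Qed.

Lemma gpull_id (X : ringedSpace) s : gpull (mor_id X) s = s.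
Proof. exact: res_id. Qed.

Section Factor.
Variables (T X : scheme) (f : mor T X) (U : opens X).
Hypothesis fU : forall y, oset U (f y).

(** The formula for [pull] is needed as well as the factorization, because not
    all sections over [U] come from [X]. *)
Lemma mor_factor : exists g : mor T (open_subscheme U),
  mor_comp (open_incl U) g = f /\
  forall (V : opens (open_subscheme U)) (O : opens T) (h : O `<=` g @^-1` V)
    (k : O `<=` f @^-1` sub_image V) s, pull g h s = pull f k s.
Proof.
pose g0 (y : T) : open_subscheme U := exist _ (f y) (asboolT (fU y)).
have g0E y : sub_incl (g0 y) = f y by [].
have g0c : continuous g0.
  apply/continuousP => _ [A oA <-].
  by have := (continuousP _).1 (@mor_cont _ _ f) A oA.
have sub (V : opens (open_subscheme U)) (O : opens T) :
    O `<=` g0 @^-1` V -> O `<=` f @^-1` sub_image V.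
  by move=> h y /h Vy; exists (g0 y).
pose g0pull (V : opens (open_subscheme U)) (O : opens T) (h : O `<=` g0 @^-1` V) :
  {rmorphism sec V -> sec O} := @pull _ _ f (sub_image V) O (sub V O h).
have l1 (V V' : opens (open_subscheme U)) (O O' : opens T)
    (h : O `<=` g0 @^-1` V) (h' : O' `<=` g0 @^-1` V')
    (hV : V' `<=` V) (hO : O' `<=` O) s :
    res hO (g0pull V O h s) = g0pull V' O' h' (res hV s).
  exact: (@pull_res _ _ f _ _ _ _ (sub V O h) (sub V' O' h') (sub_image_mono hV) hO s).
have l2 (V : opens (open_subscheme U)) (O : opens T) (h : O `<=` g0 @^-1` V)
    (s : sec V) y : oset O y -> unit_at (g0pull V O h s) y -> unit_at s (g0 y).
  by move=> Oy us; apply/sub_unit_at; exact: (@pull_local _ _ f _ _ (sub V O h) s y Oy us).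
exists (@Mor T (open_subscheme U) g0 g0c g0pull l1 l2).
split; last by move=> V O h k s; exact: (@pull_irr _ _ f (sub_image V) O (sub V O h) k s).
apply: mor_ext => [//|V O h h' s] /=.
by rewrite /g0pull -(pull_res h' _ _ (@subset_refl _ O)) res_id.
Qed.
End Factor.

Section EtaleObjects.
Variable X : scheme.
Implicit Types V N : etaleOver X.

Definition et_open N (U : opens N) : etaleOver X :=
  EtaleOver (etale_open (U := U) (@estr_etale X N)).

Definition et_incl N (U : opens N) : etmor (et_open U) N :=
  @EtMor X (et_open U) N (open_incl U) erefl.

Lemma et_compE V N W (f : etmor V N) (g : etmor W V) s :
  gpull (et_comp f g) s = gpull g (gpull f s).
Proof. exact: gpull_comp. Qed.

Lemma et_comp1f V N (f : etmor V N) : et_comp (et_id N) f = f.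
Proof. by apply: et_ext; exact: mor_comp1f. Qed.

Lemma et_compf1 V N (f : etmor V N) : et_comp f (et_id V) = f.
Proof. by apply: et_ext; exact: mor_compf1. Qed.

Lemma et_factor V N (f : etmor V N) (D : opens V) (U : opens N) :
    (forall y, oset D y -> oset U (f y)) ->
  exists g : etmor (et_open D) (et_open U),
    et_comp (et_incl U) g = et_comp f (et_incl D).
Proof.
move=> fD; have [|g [gE _]] := @mor_factor (open_subscheme D) N (mor_comp f (open_incl D)) U.
  by move=> y; apply: fD; exact: sub_inclP.
have go : mor_comp (estr (et_open U)) g = estr (et_open D).
  by rewrite /= -mor_compA gE mor_compA emor_over.
by exists (@EtMor X (et_open D) (et_open U) g go); apply: et_ext.
Qed.

Lemma et_shrink V (D U : opens V) (h : D `<=` U) :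
  exists g : etmor (et_open D) (et_open U), et_comp (et_incl U) g = et_incl D /\
    forall (k : sub_image (openW (sub_space D)) `<=` sub_image (openW (sub_space U)))
      (s : gsec (et_open U)), gpull g s = res k s.
Proof.
have [|g [gE gP]] := @mor_factor (open_subscheme D) V (open_incl D) U.
  by move=> y; apply: h; exact: sub_inclP.
have go : mor_comp (estr (et_open U)) g = estr (et_open D).
  by rewrite /= -mor_compA gE.
exists (@EtMor X (et_open D) (et_open U) g go); split; first exact: et_ext.
move=> k s; rewrite /gpull /=.
have k' : oset (openW (open_subscheme D)) `<=` open_incl D @^-1` sub_image (openW (sub_space U)).
  by move=> y _; rewrite sub_imageT; apply: h; exact: sub_inclP.
by rewrite (gP _ _ _ k') (open_morE _ k).
Qed.

Lemma et_inclE V (U : opens V) (z : gsec V)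
    (k : sub_image (openW (sub_space U)) `<=` openW V) :
  gpull (et_incl U) z = res k z.
Proof. exact: (open_morE _ k z). Qed.

Lemma gsec_sep V (z z' : gsec V) :
  (forall y : V, exists U : opens V, oset U y /\
    gpull (et_incl U) z = gpull (et_incl U) z') -> z = z'.
Proof.
move=> loc; apply: (@sec_separated V {U : opens V | gpull (et_incl U) z = gpull (et_incl U) z'}
  (openW V) (fun U => sub_image (openW (sub_space (sval U)))) (fun _ => @subsetT _ _)).
  move=> y _; have [U [Uy e]] := loc y; exists (exist _ U e) => //=.
  by have [u <-] := sub_incl_onto Uy; exists u.
by move=> [U e] /=; rewrite -!et_inclE.
Qed.

(** Compatibility is required only for inclusions between members of the
    basis [P], which determines the sections on overlaps. *)
Lemma gsec_glue V (P : set (opens V)) (t : forall U : opens V, gsec (et_open U)) :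
    (forall (y : V) (O : opens V), oset O y ->
       exists U : opens V, [/\ P U, oset U y & U `<=` O]) ->
    (forall (U D : opens V) (g : etmor (et_open D) (et_open U)), P U -> P D ->
       et_comp (et_incl U) g = et_incl D -> gpull g (t U) = t D) ->
  exists z : gsec V, forall U : opens V, P U -> gpull (et_incl U) z = t U.
Proof.
move=> bas comp.
pose J := {U : opens V | P U}.
pose im (U : opens V) := sub_image (openW (sub_space U)).
have [||z zE] := @sec_glue V J (openW V) (fun U => im (sval U)) (fun _ => @subsetT _ _) _
  (fun U => t (sval U)).
- move=> y _; have [U [PU Uy _]] := bas y (openW V) I; exists (exist _ U PU) => //=.
  by have [u <-] := sub_incl_onto Uy; exists u.
- move=> [U PU] [U' PU'] O /= hU hU'.
  apply: (@sec_separated V {D : opens V | P D /\ im D `<=` O} O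
    (fun D => im (sval D)) (fun D => (proj2_sig D).2)).
    move=> y Oy; have [D [PD Dy DO]] := bas y O Oy.
    have iO : im D `<=` O by rewrite /im sub_imageT.
    exists (exist _ D (conj PD iO)) => //=.
    by have [u <-] := sub_incl_onto Dy; exists u.
  move=> [D [PD DO]] /=.
  have key (W : opens V) (hW : O `<=` im W) : P W -> res DO (res hW (t W)) = t D.
    move=> PW; have DW : D `<=` W.
      by rewrite -(sub_imageT D) -(sub_imageT W); exact: subset_trans DO hW.
    have [g [gi gE]] := et_shrink DW.
    have k : im D `<=` im W := subset_trans DO hW.
    by rewrite (res_comp hW DO k) -(gE k); exact: comp.
  by rewrite [LHS](res_irr _ DO) [RHS](res_irr _ DO) !key.
exists z => U PU; have := zE (exist _ U PU) => /= <-; exact: et_inclE.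
Qed.

End EtaleObjects.

Lemma etale_id (X : scheme) : etale (mor_id X).
Proof.
move=> x; have [U [Ux aU]] := scheme_affine x.
exists U, U, (@subset_refl _ _); split=> //.
have idE (s : sec U) : pull (mor_id X) (@subset_refl _ (oset U) : U `<=` mor_id X @^-1` U) s = s.
  exact: res_id.
split.
  exists 0%N, (fun _ => 0) => S SA _ _ _ y; rewrite -[y]idE; exact: SA.
move=> C D pi _ _ f g fg; exists f; split.
- by move=> a; rewrite idE.
- by move=> b; rewrite fg idE.
- by move=> h' h'f _ b; rewrite -[b]idE h'f idE.
Qed.

Definition et_base (X : scheme) : etaleOver X := EtaleOver (@etale_id X).

Lemma et_base_open_immersion (X : scheme) (U : opens X) :
  open_immersion (estr (@et_open X (et_base X) U)).
Proof. rewrite /= mor_comp1f; exact: open_immersion_incl. Qed.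

(** * Extending homomorphisms from an affine object *)

Lemma homSec_ext (X : scheme) (q : nat) (M : frobModule X q) (U : etaleOver X)
    (f g : homSec M U) :
  (forall (V : etaleOver X) (a : etmor V U) (m : M V), happ f a m = happ g a m) -> f = g.
Proof.
case: f g => [f fF fR] [g gF gR] /= e.
have {}e : f = g.
  apply: functional_extensionality_dep => V.
  by apply: functional_extensionality_dep => a; apply: linear_ext => m; exact: e.
by subst g; rewrite (Prop_irrelevance fF gF) (Prop_irrelevance fR gR).
Qed.

Lemma homSec_exists (X : scheme) (q : nat) (M : frobModule X q) (U : etaleOver X)
    (F : forall V : etaleOver X, etmor V U -> M V -> gsec V) :
    (forall V a m m', F V a (m + m') = F V a m + F V a m') ->
    (forall V a s m, F V a (s *: m) = s * F V a m) ->
    (forall V a m, F V a (mF M m) = F V a m ^+ q) ->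
    (forall V V' a (e : etmor V' V) m,
       F V' (et_comp a e) (mres M e m) = gpull e (F V a m)) ->
  exists f : homSec M U, forall V (a : etmor V U) m, happ f a m = F V a m.
Proof.
move=> FD FZ FF FR.
have lin V (a : etmor V U) : exists g : {linear M V -> (gsec V)^o}, g =1 F V a.
  by apply: linear_exists; [exact: FD|exact: FZ].
pose h V (a : etmor V U) := sval (cid (lin V a)).
have hE V (a : etmor V U) m : h V a m = F V a m by exact: (svalP (cid (lin V a)) m).
have h1 V (a : etmor V U) m : h V a (mF M m) = (h V a m : gsec V) ^+ q.
  by rewrite !hE FF.
have h2 V V' (a : etmor V U) (e : etmor V' V) m :
    h V' (et_comp a e) (mres M e m) = gpull e (h V a m).
  by rewrite !hE FR.
by exists (HomSec h1 h2).
Qed.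

Section Extension.
Variables (X : scheme) (q : nat) (M : frobModule X q).
Hypotheses (qcM : quasi_coherent M)
  (frobD : forall (V : etaleOver X) (a b : gsec V), (a + b) ^+ q = a ^+ q + b ^+ q).
Variables (W N : etaleOver X) (affW : affine_scheme W) (c : etmor N W).
Implicit Types V : etaleOver X.

Lemma frob_semilinear V : semilinear_map (fun a : gsec V => a ^+ q)
  ((fun y : gsec V => y ^+ q) : (gsec V)^o -> (gsec V)^o).
Proof. by split=> [x y|a x]; [exact: frobD|exact: exprMn]. Qed.

Lemma affine_hom_ext V (a : etmor V N) (C : comPzRingType) (P : lmodType C)
    (f g : M V -> P) (theta : gsec V -> C) : affine_scheme V ->
    semilinear_map theta f -> semilinear_map theta g ->
    (forall m, f (mres M (et_comp c a) m) = g (mres M (et_comp c a) m)) ->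
  f =1 g.
Proof. by move=> affV; apply: (base_change_ext (qcM (et_comp c a) affW affV)). Qed.

(** The extension of [psi] to affine objects over [N] comes from base change;
    its values over other objects are obtained by gluing. *)
Section Extend.
Variable psi : M W -> (gsec N)^o.
Hypotheses (psi_lin : semilinear_map (gpull c) psi)
  (psiF : forall m, psi (mF M m) = (psi m : gsec N) ^+ q).

Definition extends V (a : etmor V N) (phi : {linear M V -> (gsec V)^o}) : Prop :=
  forall m, phi (mres M (et_comp c a) m) = gpull a (psi m).

Lemma extends_exists V (a : etmor V N) : affine_scheme V -> exists phi, extends a phi.
Proof.
move=> affV; have [_ univ] := qcM (et_comp c a) affW affV.
have [|phi [phiE _]] := univ (gsec V)^o (fun m => gpull a (psi m)); last by exists phi.
have [psiD psiZ] := psi_lin; split=> [x y|s x]; first by rewrite psiD rmorphD.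
rewrite psiZ et_compE; exact: rmorphM.
Qed.

Lemma extends_res V V' (a : etmor V N) (e : etmor V' V) phi phi' :
    affine_scheme V -> extends a phi -> extends (et_comp a e) phi' ->
  forall m, phi' (mres M e m) = gpull e (phi m).
Proof.
move=> affV ea ee; have [eD eZ] := mres_semilinear M e.
apply: (affine_hom_ext (a := a) (P := (gsec V')^o) (theta := gpull e) affV).
- by split=> [x y|s x]; [rewrite eD linearD|rewrite eZ linearZ].
- by split=> [x y|s x]; [rewrite linearD rmorphD|rewrite linearZ /= rmorphM].
by move=> m; rewrite -mres_comp -et_compA ee ea et_compE.
Qed.

Lemma extends_frob V (a : etmor V N) phi : affine_scheme V -> extends a phi ->
  forall m, phi (mF M m) = (phi m : gsec V) ^+ q.
Proof.
move=> affV ea; have [FD FZ] := mF_semilinear M V; have [qD qZ] := frob_semilinear V.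
apply: (affine_hom_ext (a := a) (P := (gsec V)^o) (theta := fun s => s ^+ q) affV).
- by split=> [x y|s x]; [rewrite FD linearD|rewrite FZ linearZ].
- split=> [x y|s x]; first by rewrite linearD; exact: frobD.
  by rewrite linearZ /= exprMn.
by move=> m; rewrite -mF_res !ea psiF rmorphXn.
Qed.

(** The image of [m] is characterized on all affine objects over [V], not only
    on open subsets, so that the characterization is stable under pullback. *)
Definition extension_value V (a : etmor V N) (m : M V) (t : gsec V) : Prop :=
  forall V' (e : etmor V' V) phi, affine_scheme V' -> extends (et_comp a e) phi ->
    gpull e t = phi (mres M e m).

Lemma affine_et_basis V (y : V) (O : opens V) : oset O y ->
  exists U : opens V, [/\ affine_scheme (et_open U), oset U y & U `<=` O].
Proof.
move=> Oy; have [U [Uy aU UO]] := affine_basis Oy; exists U; split=> //.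
exact: open_subscheme_affine.
Qed.

Lemma extension_value_uniq V (a : etmor V N) m t t' :
  extension_value a m t -> extension_value a m t' -> t = t'.
Proof.
move=> ht ht'; apply: gsec_sep => y.
have [U [aU Uy _]] := affine_et_basis (O := openW V) (y := y) I.
have [phi ephi] := extends_exists (et_comp a (et_incl U)) aU.
by exists U; split=> //; rewrite (ht _ _ phi) // (ht' _ _ phi).
Qed.

Lemma extension_value_exists V (a : etmor V N) m : exists t, extension_value a m t.
Proof.
have exphi : forall U : opens V,
    exists phi : {linear M (et_open U) -> (gsec (et_open U))^o},
    affine_scheme (et_open U) -> extends (et_comp a (et_incl U)) phi.
  move=> U; have [aU|naU] := pselect (affine_scheme (et_open U)).
    by have [phi ephi] := extends_exists (et_comp a (et_incl U)) aU; exists phi.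
  by exists \0.
pose phi U := sval (cid (exphi U)).
have phiE U : affine_scheme (et_open U) -> extends (et_comp a (et_incl U)) (phi U).
  exact: (svalP (cid (exphi U))).
have [||z zE] := @gsec_glue X V [set U | affine_scheme (et_open U)]
    (fun U => phi U (mres M (et_incl U) m)).
- by move=> y O Oy; exact: affine_et_basis.
- move=> U D g aU aD gE.
  rewrite -(extends_res (phi' := phi D) aU (phiE U aU)) -?mres_comp ?gE //.
  by rewrite -et_compA gE; exact: phiE.
exists z => V' e psi' aV' ee; apply: gsec_sep => y.
have [U [aU Uy _]] := affine_et_basis (O := openW V) (y := e y) I.
have [D [aD Dy DU]] := affine_et_basis (O := opre e U) (y := y) Uy.
exists D; split=> //.
have [|g gE] := et_factor (f := e) (D := D) (U := U); first by move=> v /DU.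
have [phiD ephiD] := extends_exists (et_comp (et_comp a e) (et_incl D)) aD.
rewrite -(extends_res aV' ee ephiD) -et_compE -gE et_compE zE //.
rewrite -(extends_res (phi' := phiD) aU (phiE U aU)) -?mres_comp ?gE //.
by rewrite -et_compA gE et_compA.
Qed.

Lemma hom_extension : exists f : homSec M N, forall V (a : etmor V N) m,
  happ f a (mres M (et_comp c a) m) = gpull a (psi m).
Proof.
pose F V (a : etmor V N) m := sval (cid (extension_value_exists a m)).
have FP V (a : etmor V N) m : extension_value a m (F V a m).
  exact: (svalP (cid (extension_value_exists a m))).
have FD V (a : etmor V N) m m' : F V a (m + m') = F V a m + F V a m'.
  apply: extension_value_uniq (FP _ _ _) _ => V' e phi aV' ee.
  have [eD _] := mres_semilinear M e.
  by rewrite rmorphD eD linearD (FP V a m V' e phi) // (FP V a m' V' e phi).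
have FZ V (a : etmor V N) s m : F V a (s *: m) = s * F V a m.
  apply: extension_value_uniq (FP _ _ _) _ => V' e phi aV' ee.
  have [_ eZ] := mres_semilinear M e.
  by rewrite rmorphM eZ linearZ (FP V a m V' e phi).
have FF V (a : etmor V N) m : F V a (mF M m) = F V a m ^+ q.
  apply: extension_value_uniq (FP _ _ _) _ => V' e phi aV' ee.
  by rewrite rmorphXn mF_res (extends_frob aV' ee) (FP V a m V' e phi).
have FR V V' (a : etmor V N) (e : etmor V' V) m :
    F V' (et_comp a e) (mres M e m) = gpull e (F V a m).
  apply: extension_value_uniq (FP _ _ _) _ => V'' e' phi aV'' ee.
  rewrite -et_compE -mres_comp; apply: (FP V a m) => //.
  by rewrite et_compA.
have [f fE] := homSec_exists FD FZ FF FR.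
exists f => V a m; rewrite fE.
apply: extension_value_uniq (FP _ _ _) _ => V' e phi aV' ee.
by rewrite -et_compE -ee et_compA mres_comp.
Qed.

End Extend.

(** The agreement locus in [M W] is a submodule stable under Frobenius, so
    agreement on generators gives agreement on [M W]; base change and gluing
    propagate it to all objects over [N]. *)
Lemma homSec_eq_generators (f g : homSec M N) n (m : 'I_n -> M W) :
    (forall x, exists d (a : 'I_d -> 'I_n -> gsec W),
       x = \sum_(j < n) \sum_(i < d) a i j *: iter i (mF M) (m j)) ->
    (forall j, happ f (et_id N) (mres M c (m j)) = happ g (et_id N) (mres M c (m j))) ->
  f = g.
Proof.
move=> gen fg.
have aff V (a : etmor V N) : affine_scheme V -> forall x, happ f a x = happ g a x.
  move=> affV; apply: (affine_hom_ext (a := a) (P := (gsec V)^o) (theta := id) affV).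
  - by split=> [x y|s x]; [rewrite linearD|rewrite linearZ].
  - by split=> [x y|s x]; [rewrite linearD|rewrite linearZ].
  have [eD eZ] := mres_semilinear M (et_comp c a).
  pose E : set (M W) := [set x | happ f a (mres M (et_comp c a) x) =
                                 happ g a (mres M (et_comp c a) x)].
  have ED x y : E x -> E y -> E (x + y) by rewrite /E /= eD !linearD => -> ->.
  have EZ s x : E x -> E (s *: x) by rewrite /E /= eZ !linearZ => ->.
  have E0 : E 0 by rewrite /E /= (semilinear0 (mres_semilinear M (et_comp c a))) !linear0.
  have EF x : E x -> E (mF M x) by rewrite /E /= mF_res !happ_F => ->.
  have Em j : E (m j).
    have k h : happ h a (mres M a (mres M c (m j))) =
        gpull a (happ h (et_id N) (mres M c (m j))) by rewrite -happ_res et_comp1f.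
    by rewrite /E /= mres_comp !k fg.
  move=> x; have [d [b ->]] := gen x; suff : E (\sum_j \sum_i b i j *: iter i (mF M) (m j)) by [].
  elim/big_ind: _ => // j _; elim/big_ind: _ => // i _; apply: EZ.
  by elim: (nat_of_ord i) => //= e; exact: EF.
apply: homSec_ext => V a x; apply: gsec_sep => y.
have [U [aU Uy _]] := affine_et_basis (O := openW V) (y := y) I.
by exists U; split=> //; rewrite -!happ_res aff.
Qed.
End Extension.

(** * Étale neighbourhoods and germs *)

Section Neighbourhoods.
Variables (X : scheme) (x : X).
Implicit Types N K : etNbhd x.

Definition nb_id N : nbmor N N := @NbMor X x N N (et_id N) erefl.

Lemma nb_comp_pt N K L (f : nbmor K N) (g : nbmor L K) : et_comp f g (npt L) = npt N.
Proof. by rewrite -(nmor_pt f) -(nmor_pt g). Qed.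
Definition nb_comp N K L (f : nbmor K N) (g : nbmor L K) : nbmor L N :=
  NbMor (nb_comp_pt f g).

Definition nb_open N (U : opens N) (u : et_open U) (uE : sub_incl u = npt N) : etNbhd x :=
  @EtNbhd X x (et_open U) u (etrans (congr1 (estr N) uE) (npt_over N)).

Lemma affine_nbhd N : exists K (a : nbmor K N), affine_scheme K.
Proof.
have [U [aU Uy _]] := affine_et_basis (O := openW N) (y := npt N) I.
have [u uE] := sub_incl_onto Uy.
by exists (nb_open uE), (@NbMor X x (nb_open uE) N (et_incl U) uE).
Qed.

Section Stalk.
Variables (S : etaleOver X -> Type)
  (rS : forall U V : etaleOver X, etmor V U -> S U -> S V)
  (rS_id : forall U s, @rS U U (et_id U) s = s)
  (L : Type) (germ : forall N, S N -> L).
Hypothesis stalk : is_stalk rS germ.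

Lemma germ_res N K (a : nbmor K N) s : germ (rS a s) = germ s.
Proof.
by apply/(stalk.2); exists K, (nb_id K), a; rewrite rS_id.
Qed.

Lemma germ_eq N N' (s : S N) (s' : S N') : germ s = germ s' ->
  exists K (a : nbmor K N) (b : nbmor K N'), rS a s = rS b s'.
Proof. by move/(stalk.2). Qed.
End Stalk.

Section Ring.
Variable Ox : ringStalk x.

Lemma rgerm_res N K (a : nbmor K N) s : rgerm Ox K (gpull a s) = rgerm Ox N s.
Proof.
exact: (germ_res (rS := fun U V g => gpull g) (fun U => @gpull_id U) (rstalkP Ox)).
Qed.

(** Two neighbourhoods are dominated by a third one, because the zero sections
    over them have the same germ. *)
Lemma nbhd_refine N N' : exists K, inhabited (nbmor K N * nbmor K N')%type.
Proof.
have [|K [a [b _]]] := germ_eq (rstalkP Ox) (N := N) (N' := N') (s := 0) (s' := 0).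
  by rewrite !rmorph0.
by exists K; constructor.
Qed.

Lemma rgerm_eq0 N (s : gsec N) : rgerm Ox N s = 0 ->
  exists K (a : nbmor K N), gpull a s = 0.
Proof.
move=> s0; have [|K [a [b e]]] := germ_eq (rstalkP Ox) (N' := N) (s := s) (s' := 0).
  by rewrite rmorph0.
by exists K, a; rewrite e rmorph0.
Qed.

Lemma rgerm_all_eq0 N (l : seq (gsec N)) : (forall s, s \in l -> rgerm Ox N s = 0) ->
  exists K (a : nbmor K N), forall s, s \in l -> gpull a s = 0.
Proof.
elim: l => [|s l IH] hl; first by exists N, (nb_id N).
have [|K [a ha]] := IH; first by move=> t tl; apply: hl; rewrite inE tl orbT.
have [|K' [b hb]] := @rgerm_eq0 K (gpull a s).
  by rewrite rgerm_res; apply: hl; exact: mem_head.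
exists K', (nb_comp a b) => t; rewrite inE et_compE => /orP[/eqP->//|/ha->].
exact: rmorph0.
Qed.

Lemma rgerm_lift N n (beta : 'I_n -> Ox) : exists K (a : nbmor K N) (b : 'I_n -> gsec K),
  forall j, rgerm Ox K (b j) = beta j.
Proof.
suff H m : exists K (a : nbmor K N) (b : 'I_n -> gsec K),
    forall j : 'I_n, (j < m)%N -> rgerm Ox K (b j) = beta j.
  by have [K [a [b hb]]] := H n; exists K, a, b => j; exact: hb.
elim: m => [|m [K [a [b hb]]]]; first by exists N, (nb_id N), (fun _ => 0).
have [lt|ge] := ltnP m n; last first.
  exists K, a, b => j _; apply: hb; exact: leq_trans (ltn_ord j) ge.
have [N' [s sE]] := (rstalkP Ox).1 (beta (Ordinal lt)).
have [K' [[c d]]] := nbhd_refine K N'.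
exists K', (nb_comp a c), (fun j : 'I_n => if (j < m)%N then gpull c (b j) else gpull d s) => j.
rewrite ltnS leq_eqVlt => /orP[/eqP jm|jm].
  by rewrite jm ltnn rgerm_res sE; congr beta; apply: val_inj.
by rewrite jm rgerm_res hb.
Qed.
End Ring.

End Neighbourhoods.

(** * The natural map on stalks *)

Section NaturalMap.
Variables (X : scheme) (q : nat) (M : frobModule X q) (x : X).
Variables (Ox : ringStalk x) (Mx : modStalk M Ox) (Hx : homStalk M x).
Hypothesis frobD : forall (V : etaleOver X) (a b : gsec V),
  (a + b) ^+ q = a ^+ q + b ^+ q.
Implicit Types N K : etNbhd x.

Lemma mgerm_res N K (a : nbmor K N) (m : M N) : mgerm Mx (mres M a m) = mgerm Mx m.
Proof. exact: (germ_res (rS := @mres X q M) (@mres_id X q M) (mstalkP Mx)). Qed.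

Lemma hom_res_id (U : etaleOver X) (f : homSec M U) : hom_res (et_id U) f = f.
Proof. by apply: homSec_ext => V g m /=; rewrite et_comp1f. Qed.

Lemma hgerm_res N K (a : nbmor K N) (f : homSec M N) : hgerm Hx (hom_res a f) = hgerm Hx f.
Proof. exact: (germ_res (rS := @hom_res X q M) hom_res_id (hstalkP Hx)). Qed.

Lemma frobB (V : etaleOver X) (a b : gsec V) : (a - b) ^+ q = a ^+ q - b ^+ q.
Proof. by apply: (addIr (b ^+ q)); rewrite -frobD !subrK. Qed.

Lemma homSec_sub (U : etaleOver X) (f g : homSec M U) : exists h : homSec M U,
  forall (V : etaleOver X) (a : etmor V U) m, happ h a m = happ f a m - happ g a m.
Proof.
apply: (@homSec_exists _ _ _ _ (fun V a m => (happ f a m : gsec V) - happ g a m)).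
- move=> V a m m'; transitivity (((happ f a m : gsec V) + happ f a m') -
    ((happ g a m : gsec V) + happ g a m')); first by rewrite !linearD.
  by rewrite opprD addrACA.
- move=> V a s m; transitivity (s * (happ f a m : gsec V) - s * (happ g a m : gsec V)).
    by rewrite !linearZ.
  by rewrite mulrBr.
- by move=> V a m; rewrite !happ_F frobB.
- by move=> V V' a e m; rewrite !happ_res rmorphB.
Qed.

Lemma homSec_add (U : etaleOver X) (f g : homSec M U) : exists h : homSec M U,
  forall (V : etaleOver X) (a : etmor V U) m, happ h a m = happ f a m + happ g a m.
Proof.
apply: (@homSec_exists _ _ _ _ (fun V a m => (happ f a m : gsec V) + happ g a m)).
- move=> V a m m'; transitivity (((happ f a m : gsec V) + happ f a m') +
    ((happ g a m : gsec V) + happ g a m')); first by rewrite !linearD.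
  by rewrite addrACA.
- move=> V a s m; transitivity (s * (happ f a m : gsec V) + s * (happ g a m : gsec V)).
    by rewrite !linearZ.
  by rewrite mulrDr.
- by move=> V a m; rewrite !happ_F frobD.
- by move=> V V' a e m; rewrite !happ_res rmorphD.
Qed.

(** The difference of the two pullbacks of [f] is a homomorphism over [K] with
    germ zero, hence vanishes on some [K'].  Equality of the germs of the
    pullbacks themselves would only equate their pullbacks along two different
    maps to [K]. *)
Lemma hom_res_equalize N K (c c' : nbmor K N) (f : homSec M N) :
  exists K' (e : nbmor K' K), hom_res (nb_comp c e) f = hom_res (nb_comp c' e) f.
Proof.
have [d dE] := homSec_sub (hom_res c f) (hom_res c' f).
have [z zE] := homSec_sub d d.
have hd : hgerm Hx d = 0.
  apply: (addIr (hgerm Hx (hom_res c' f))).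
  rewrite add0r -(@hgerm_add _ _ _ _ Hx _ _ _ (hom_res c f)).
    by rewrite !hgerm_res.
  by move=> V a m; rewrite dE subrK.
have hz : hgerm Hx z = 0.
  apply: (addIr (hgerm Hx z)); rewrite add0r -(@hgerm_add _ _ _ _ Hx _ _ _ z) //.
  by move=> V a m; rewrite zE subrr addr0.
have [K' [e [e' ee]]] := germ_eq (hstalkP Hx) (etrans hd (esym hz)).
exists K', e; apply: homSec_ext => V a m /=.
apply/eqP; rewrite -subr_eq0; apply/eqP.
have := congr1 (fun h : homSec M K' => happ h a m) ee.
by rewrite /= dE zE subrr /= !et_compA.
Qed.

(** The graph of the natural map, in terms of representatives over a common
    neighbourhood. *)
Definition natural_rel (h : Hx) (mu : Mx) (w : Ox) : Prop :=
  exists N (f : homSec M N) (m : M N),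
    [/\ hgerm Hx f = h, mgerm Mx m = mu & w = rgerm Ox N (happ f (et_id N) m)].

Lemma rgerm_happ N K (a : nbmor K N) (f : homSec M N) (m : M N) :
  rgerm Ox N (happ f (et_id N) m) = rgerm Ox K (happ (hom_res a f) (et_id K) (mres M a m)).
Proof.
by rewrite -(rgerm_res Ox a) -happ_res /= et_comp1f et_compf1.
Qed.

Lemma hom_res_comp N K K' (a : nbmor K N) (b : nbmor K' K) (f : homSec M N) :
  hom_res (nb_comp a b) f = hom_res b (hom_res a f).
Proof. by apply: homSec_ext => V g m /=; rewrite et_compA. Qed.

(** On a common refinement each [f] is reached in two ways, through the
    equality of the germs of the homomorphisms and through that of the germs of
    the sections; [hom_res_equalize] identifies them, once for each [f]. *)
Lemma natural_rel_uniq h mu w w' : natural_rel h mu w -> natural_rel h mu w' -> w = w'.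
Proof.
move=> [N1 [f1 [m1 [h1 mu1 ->]]]] [N2 [f2 [m2 [h2 mu2 ->]]]].
have [W1 [a1 [a2 ea]]] := germ_eq (hstalkP Hx) (etrans h1 (esym h2)).
have [W2 [c1 [c2 ec]]] := germ_eq (mstalkP Mx) (etrans mu1 (esym mu2)).
have [W3 [[d1 d2]]] := nbhd_refine Ox W1 W2.
have [W4 [e e1]] := hom_res_equalize (nb_comp a1 d1) (nb_comp c1 d2) f1.
have [W5 [e' e2]] := hom_res_equalize (nb_comp (nb_comp a2 d1) e) (nb_comp (nb_comp c2 d2) e) f2.
rewrite (rgerm_happ (nb_comp (nb_comp (nb_comp c1 d2) e) e')).
rewrite [RHS](rgerm_happ (nb_comp (nb_comp (nb_comp c2 d2) e) e')).
rewrite -e2 [hom_res _ f1]hom_res_comp -e1 !hom_res_comp ea.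
by rewrite /= !mres_comp ec.
Qed.

Lemma natural_rel_germ h mu N : exists K (a : nbmor K N) (f : homSec M K) (m : M K),
  hgerm Hx f = h /\ mgerm Mx m = mu.
Proof.
have [N1 [f hf]] := (hstalkP Hx).1 h; have [N2 [m hm]] := (mstalkP Mx).1 mu.
have [K1 [[a b]]] := nbhd_refine Ox N N1; have [K [[c d]]] := nbhd_refine Ox K1 N2.
exists K, (nb_comp a c), (hom_res (nb_comp b c) f), (mres M d m).
by rewrite hgerm_res mgerm_res.
Qed.

Lemma natural_map_exists : exists Phi : Hx -> stalkHom Mx,
  is_natural_map Phi /\ forall (h h' : Hx) (m : Mx), Phi (h + h') m = Phi h m + Phi h' m.
Proof.
have ex h mu : exists w, natural_rel h mu w.
  have [W _] := (hstalkP Hx).1 h.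
  have [K [a [f [m [hf hm]]]]] := natural_rel_germ h mu W.
  by exists (rgerm Ox K (happ f (et_id K) m)), K, f, m.
pose P h mu := sval (cid (ex h mu)).
have PE N (f : homSec M N) (m : M N) :
    P (hgerm Hx f) (mgerm Mx m) = rgerm Ox N (happ f (et_id N) m).
  apply: natural_rel_uniq (svalP (cid (ex _ _))) _.
  by exists N, f, m.
have two h mu mu' : exists K (f : homSec M K) (m m' : M K),
    [/\ hgerm Hx f = h, mgerm Mx m = mu & mgerm Mx m' = mu'].
  have [W _] := (hstalkP Hx).1 h.
  have [K [a [f [m [hf hm]]]]] := natural_rel_germ h mu W.
  have [K' [b [_ [m' [_ hm']]]]] := natural_rel_germ h mu' K.
  by exists K', (hom_res b f), (mres M b m), m'; rewrite hgerm_res mgerm_res.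
have PD h mu mu' : P h (mu + mu') = P h mu + P h mu'.
  have [K [f [m [m' [<- <- <-]]]]] := two h mu mu'.
  have [gD _] := mgerm_semilinear Mx K.
  by rewrite -gD !PE linearD rmorphD.
have PZ h a mu : P h (a *: mu) = a * P h mu.
  have [N [s <-]] := (rstalkP Ox).1 a.
  have [K [b [f [m [<- <-]]]]] := natural_rel_germ h mu N.
  have [_ gZ] := mgerm_semilinear Mx K.
  by rewrite -(rgerm_res Ox b) -gZ !PE linearZ rmorphM.
have PF h mu : P h (msF mu) = P h mu ^+ q.
  have [W _] := (hstalkP Hx).1 h.
  have [K [b [f [m [<- <-]]]]] := natural_rel_germ h mu W.
  by rewrite -mgerm_F !PE happ_F rmorphXn.
have lin h : exists g : {linear Mx -> Ox^o}, g =1 P h.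
  by apply: linear_exists; [exact: PD|exact: PZ].
pose L h := sval (cid (lin h)).
have LE h mu : L h mu = P h mu by exact: (svalP (cid (lin h)) mu).
have LF h mu : L h (msF mu) = (L h mu : Ox) ^+ q by rewrite !LE PF.
exists (fun h => StalkHom (LF h)); split=> [N f m|h h' mu] /=; first by rewrite LE PE.
rewrite !LE.
have [W _] := (hstalkP Hx).1 h.
have [K [b [f [m [<- <-]]]]] := natural_rel_germ h mu W.
have [K' [c [f' [_ [<- _]]]]] := natural_rel_germ h' mu K.
have [g gE] := homSec_add (hom_res c f) f'.
rewrite -(hgerm_res c) -(mgerm_res c) -(@hgerm_add _ _ _ _ Hx _ _ _ g) //.
by rewrite !PE gE rmorphD.
Qed.

End NaturalMap.

(** * Bijectivity of the natural map *)

Lemma stalkHom_ext (X : scheme) (q : nat) (M : frobModule X q) (x : X)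
    (Ox : ringStalk x) (Mx : modStalk M Ox) (f g : stalkHom Mx) :
  (forall m, f m = g m) -> f = g.
Proof.
case: f g => [f fF] [g gF] /= /linear_ext e; subst g.
by rewrite (Prop_irrelevance fF gF).
Qed.

Lemma frob_semilinear_comb (R S : comPzRingType) (theta : R -> S) (q : nat)
    (M : lmodType R) (F : M -> M) (T : M -> S^o) n d (m : 'I_n -> M)
    (a : 'I_d -> 'I_n -> R) :
    semilinear_map theta T -> (forall y, T (F y) = (T y : S) ^+ q) ->
  T (\sum_j \sum_i a i j *: iter i F (m j)) =
    \sum_j \sum_i theta (a i j) * (T (m j) : S) ^+ (q ^ i).
Proof.
move=> sT TF; have [TD _] := sT.
have Ti i y : T (iter i F y) = (T y : S) ^+ (q ^ i).
  by elim: i => [|i IH]; rewrite ?expn0 ?expr1 //= TF IH -exprM expnSr.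
rewrite (big_morph T TD (semilinear0 sT)); apply: eq_bigr => j _.
rewrite (semilinear_sum _ _ _ _ sT); apply: eq_bigr => i _.
by rewrite Ti.
Qed.

Section Comparison.
Variables (X : scheme) (q : nat) (M : frobModule X q) (x : X).
Variables (Ox : ringStalk x) (Mx : modStalk M Ox) (Hx : homStalk M x).
Hypotheses (qcM : quasi_coherent M)
  (frobD : forall (V : etaleOver X) (a b : gsec V), (a + b) ^+ q = a ^+ q + b ^+ q).
Variables (W : etNbhd x) (affW : affine_scheme W) (n : nat) (m : 'I_n -> M W).
Hypothesis gen : forall y : M W, exists d (a : 'I_d -> 'I_n -> gsec W),
  y = \sum_(j < n) \sum_(i < d) a i j *: iter i (mF M) (m j).
Variable Phi : Hx -> stalkHom Mx.
Hypothesis natPhi : is_natural_map Phi.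

(** The two homomorphisms differ on the generators by finitely many sections
    with germ zero, which vanish after shrinking. *)
Lemma comparison_injective (h h' : Hx) : Phi h = Phi h' -> h = h'.
Proof.
have [N1 [f1 <-]] := (hstalkP Hx).1 h; have [N2 [f2 <-]] := (hstalkP Hx).1 h'.
have [K1 [[a1 a2]]] := nbhd_refine Ox N1 N2.
have [K [[b c]]] := nbhd_refine Ox K1 W.
rewrite -(hgerm_res Hx (nb_comp a1 b)) -(hgerm_res Hx (nb_comp a2 b)).
move: (hom_res _ f1) (hom_res _ f2) => f g e.
have [|K' [d hd]] := @rgerm_all_eq0 X x Ox K
    (codom (fun j => happ f (et_id K) (mres M c (m j)) - happ g (et_id K) (mres M c (m j)))).
  move=> _ /codomP[j ->]; rewrite rmorphB -!natPhi e subrr.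
  by [].
rewrite -(hgerm_res Hx d f) -(hgerm_res Hx d g); congr (hgerm Hx _).
apply: (homSec_eq_generators qcM affW (c := nb_comp c d) (m := m)) => //= j.
have hE (h0 : homSec M K) y : happ h0 d (mres M d y) = gpull d (happ h0 (et_id K) y).
  by rewrite -happ_res et_comp1f.
rewrite mres_comp et_compf1 !hE.
apply/eqP; rewrite -subr_eq0 -rmorphB; apply/eqP/hd.
exact: codom_f.
Qed.

Hypothesis fp : exists (d : nat) (l : seq 'M[gsec W]_(d, n)),
  (forall a, a \in l -> \sum_j \sum_i a i j *: iter i (mF M) (m j) = 0) /\
  forall (N : lmodType (gsec W)) (G : N -> N) (b : 'I_n -> N),
    semilinear_map (fun a : gsec W => a ^+ q) G ->
    (forall a, a \in l -> \sum_j \sum_i a i j *: iter i G (b j) = 0) ->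
  exists g : {linear M W -> N}, (forall x, g (mF M x) = G (g x)) /\ forall j, g (m j) = b j.

Lemma iter_frob (R : comPzRingType) i (b : R) : iter i (fun y => y ^+ q) b = b ^+ (q ^ i).
Proof. by elim: i => [|i IH]; rewrite ?expn0 ?expr1 //= IH -exprM expnSr. Qed.

Lemma shom_semilinear (psi : stalkHom Mx) (N : etNbhd x) :
  semilinear_map (rgerm Ox N) ((fun y : M N => psi (mgerm Mx y)) : M N -> Ox^o).
Proof.
have [gD gZ] := mgerm_semilinear Mx N.
by split=> [y z|a y]; [rewrite gD linearD|rewrite gZ linearZ].
Qed.

(** Represent the germs [psi (m j)] by sections over a neighbourhood, and
    shrink it until these satisfy the finitely many relations of [M W].  The two
    maps on germs are compared on affine neighbourhoods, where sections are
    combinations of sections over [W]. *)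
Lemma comparison_surjective (psi : stalkHom Mx) : exists h, Phi h = psi.
Proof.
have [d [l [lM lN]]] := fp.
have [K0 [c0 [b0 b0E]]] := rgerm_lift (Ox := Ox) W (fun j => psi (mgerm Mx (m j)) : Ox).
pose rel (a : 'M[gsec W]_(d, n)) : gsec K0 :=
  \sum_j \sum_i gpull c0 (a i j) * iter i (fun y => y ^+ q) (b0 j).
have [|K [c1 c1E]] := @rgerm_all_eq0 X x Ox K0 (map rel l).
  move=> _ /mapP[a al ->].
  have sT := shom_semilinear psi W.
  have := frob_semilinear_comb (F := mF M) (T := fun y => psi (mgerm Mx y)) m (fun i j => a i j) sT.
  rewrite /= lM // (semilinear0 sT) => /(_ q) -> => [|y]; last by rewrite mgerm_F shom_F.
  rewrite rmorph_sum; apply: eq_bigr => j _; rewrite rmorph_sum; apply: eq_bigr => i _.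
  by rewrite rmorphM rgerm_res iter_frob rmorphXn b0E.
pose c := nb_comp c0 c1.
pose b j : gsec K := gpull c1 (b0 j).
pose N := restrict_scalars (gpull c) (gsec K)^o.
pose G (y : N) : N := (y : gsec K) ^+ q.
have iterG i (y : N) : iter i G y = (y : gsec K) ^+ (q ^ i) by exact: iter_frob.
have [||g [gF gm]] := lN N G b.
- split=> [y z|a y]; first exact: frobD.
  transitivity ((gpull c a * (y : gsec K)) ^+ q); first by [].
  by rewrite exprMn -rmorphXn.
- move=> a al; rewrite -[RHS](c1E _ (map_f rel al)) /rel rmorph_sum.
  apply: eq_bigr => j _; rewrite rmorph_sum; apply: eq_bigr => i _.
  by rewrite iterG rmorphM -et_compE iter_frob rmorphXn.
have [||f fE] := hom_extension qcM frobD affW (c := c) (psi := g).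
- by split=> [y z|a y]; [rewrite linearD|rewrite linearZ].
- exact: gF.
exists (hgerm Hx f); apply: stalkHom_ext.
have agree (y : M W) : rgerm Ox K (g y) = psi (mgerm Mx y).
  have [d' [a ->]] := gen y.
  rewrite (frob_semilinear_comb (T := fun y => psi (mgerm Mx y)) (q := q) _ _
    (shom_semilinear psi W)) => [|z]; last by rewrite mgerm_F shom_F.
  rewrite (frob_semilinear_comb (T := fun y => rgerm Ox K (g y)) (theta := rgerm Ox W) (q := q)).
  - by apply: eq_bigr => j _; apply: eq_bigr => i _; rewrite gm rgerm_res b0E.
  - split=> [z t|s z]; first by rewrite linearD rmorphD.
    by rewrite linearZ -(rgerm_res Ox c); exact: rmorphM.
  - by move=> z; rewrite gF rmorphXn.
move=> mu; have [N1 [m1 <-]] := (mstalkP Mx).1 mu.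
have [N2 [[e1 e2]]] := nbhd_refine Ox K N1.
have [K' [e aK']] := affine_nbhd N2.
pose k := nb_comp e1 e.
rewrite -(mgerm_res Mx (nb_comp e2 e)) -(hgerm_res Hx k).
move: (mres M _ m1) => m2; rewrite natPhi.
have sf : semilinear_map (rgerm Ox K')
    ((fun y => rgerm Ox K' (happ (hom_res k f) (et_id K') y)) : M K' -> Ox^o).
  by split=> [y z|a y]; [rewrite linearD rmorphD|rewrite linearZ rmorphM].
apply: (base_change_ext (qcM (et_comp c k) affW aK') sf (shom_semilinear psi K')) => y.
transitivity (rgerm Ox K' (gpull k (g y))); first by rewrite -fE /= et_compf1.
by rewrite rgerm_res agree (mgerm_res Mx (nb_comp c k)).
Qed.

End Comparison.

Section Curve.
Variables (p r : nat) (k : closedFieldType) (X : scheme)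
  (s : {rmorphism k -> gsec X}) (pr_p : prime p) (r_gt0 : (0 < r)%N) (char_k : p \in [pchar k]).
Local Notation q := (p ^ r)%N.

Lemma gsec_char (V : etaleOver X) : p%:R = 0 :> gsec V.
Proof.
have p0 : p%:R = 0 :> gsec X by apply: (rmorph_natr_eq0 s); exact: pcharf0.
exact: (rmorph_natr_eq0 (gpull (estr V)) p0).
Qed.

(** The open subscheme has [sub_image (openW _)] as its ring of global sections,
    an open set equal to [U] but not convertible to it. *)
Lemma curve_affine_nbhd (x : X) : smooth_curve s ->
  exists (W : etNbhd x) (phi : {rmorphism {poly k} -> gsec W}),
  [/\ affine_scheme W, open_immersion (estr W), (1 : gsec W) != 0 & etale_ring phi].
Proof.
move=> [_ _ /(_ x)[U [phi [Ux aU _ ephi]]]].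
have [u uE] := sub_incl_onto Ux.
pose W : etNbhd x := @EtNbhd X x (@et_open X (et_base X) U) u uE.
have [phi' ephi'] : exists phi' : {rmorphism {poly k} -> gsec W}, etale_ring phi'.
  by rewrite /gsec /= sub_imageT; exists phi.
exists W, phi'; split=> //.
- exact: open_subscheme_affine.
- exact: et_base_open_immersion.
have aW : affine_scheme W by exact: open_subscheme_affine.
have [/(_ u I)[P0 _ _ P1 _] _ _ _] := aW.
by apply/eqP => e; apply: P1; rewrite e.
Qed.

End Curve.

Theorem proposition4p2p2 (p r : nat) (k : closedFieldType) (X : scheme)
    (s : {rmorphism k -> gsec X}) (M : frobModule X (p ^ r)%N) (x : X)
    (Ox : ringStalk x) (Mx : modStalk M Ox) (Hx : homStalk M x)
    (pr_p : prime p) (r_gt0 : (0 < r)%N) (char_k : p \in [pchar k])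
    (curveX : smooth_curve s) (unitM : unit_module M) (fgM : locally_fg M)
    (closed_x : closed [set x]) :
  exists Phi : Hx -> stalkHom Mx,
    [/\ is_natural_map Phi,
        forall (h h' : Hx) (m : Mx), Phi (h + h') m = Phi h m + Phi h' m
      & bijective Phi].
Proof.
have frobD (V : etaleOver X) (a b : gsec V) :
    (a + b) ^+ (p ^ r)%N = a ^+ (p ^ r)%N + b ^+ (p ^ r)%N.
  by apply: exprD_char => //; exact: (gsec_char s).
have [W [phi [affW immW nzW ephi]]] := curve_affine_nbhd x curveX.
have [nW [I [kappa [t [kD kM kE]]]]] :=
  etale_frobenius_basis_pz pr_p r_gt0 nzW (pcharf0 char_k) ephi.
have [n [m gen]] := fgM W affW immW.
have [qcM unitF] := unitM.
have gen' y : exists d a, y = twisted_comb (mF M) m d a.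
  have [d [a ->]] := gen y.
  exists d, (fun i j => if insub i is Some i' then a i' j else 0).
  by apply: eq_bigr => j _; apply: eq_bigr => i _; rewrite valK.
have fp := unit_hom_exists kD kM kE nW (unitF W affW) gen'.
have [Phi [natPhi addPhi]] := natural_map_exists Mx Hx frobD.
exists Phi; split=> //.
have surj psi := comparison_surjective qcM frobD affW gen natPhi fp psi.
have [inv invK] := choice surj.
exists inv => [h|//]; apply: (comparison_injective qcM affW gen natPhi).
by rewrite invK.
Qed.
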